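(* Let $(X,d)$ be a compact metric space carrying a non-atomic Borel probability measure $\mu$ which is $\delta$-regular (for some $\delta>0$, with constants $r_0>0$, $0<a<1<b$). Fix $0<t<1$ and let $u=(u_n)_{n\ge 0}$, $u_n=t^n$, and suppose $\limsup_{n\to\infty} u_n/u_{n+1}<\infty$. Let $(Q,R)$ be a system (as in the context) that is well-distributed in $X$ relative to $(\rho,u)$, where $\rho$ is $u$-regular. Let $\phi:\mathbb R^+\to\mathbb R^+$ be non-decreasing with $\lim_{x\to 0^+}\phi(x)/x=0$ and such that $\sum_{\xi\in Q}\left(\frac{\phi(R_\xi)}{R_\xi}\right)^{\delta}<\infty$. Assume $\limsup_{n\to\infty}\frac{\phi(u_n)}{\rho(u_n)}=0$. Define $$g(x)=\frac{\phi(x)^s}{\rho(x)^{\delta}},\qquad G:=\limsup_{n\to\infty} g(u_n).$$ (i) If $G=0$, then for every $s\in(0,\delta)$: if $\sum_{n=1}^\infty g(u_n)=\infty$ then $\mathcal H^s(E(Q,R,\phi))=\infty$. (ii) If $0<G\le\infty$, then $\mathcal H^s(E(Q,R,\phi))=\infty$ for every $s\in(0,\delta)$.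
   Context: Balls are taken inside $X$: $B(x,r)=\{y\in X: d(x,y)<r\}$, and the annulus $A(x,r,R)=B(x,R)\setminus B(x,r)$. $\mathcal H^s$ is the $s$-dimensional Hausdorff measure defined via covers by balls $B_i$ of radii $r_i\le\epsilon$, summing $r_i^s$ and letting $\epsilon\to 0$. System: $Q\subset X$ is countable, $R:Q\to\mathbb R^+$, $\xi\mapsto R_\xi$, and for every $M<\infty$ the set $\{\xi\in Q: R_\xi\ge M\}$ is finite. For $\phi:\mathbb R^+\to\mathbb R^+$, $W(Q,R,\phi)=\{x\in X: d(x,\xi)<\phi(R_\xi)\text{ for infinitely many }\xi\in Q\}$ and $E(Q,R,\phi)=W(Q,R,\phi)\setminus\bigcup_{0<\epsilon<1}W(Q,R,(1-\epsilon)\phi)$. $\delta$-regular: there exist $r_0>0$ and $0<a<1<b$ such that for every ball $B(x,r)$ and annulus $A(x,r,R)$ with $0<r<R\le r_0$: $a r^\delta\le\mu(B(x,r))\le b r^\delta$ and $a(R-r)^\delta\le\mu(A(x,r,R))$. $J_u(n)=\{\xi\in Q: u_n\le R_\xi<u_{n-1}\}$. Well-distributed relative to $(\rho,u)$, where $\rho:\mathbb R^+\to\mathbb R^+$ is non-decreasing with $\lim_{x\to0}\rho(x)=0$: there exist constants $0<c,\kappa<1$ such that (1) $d(\xi,\zeta)\ge c\min\{R_\xi,R_\zeta\}$ for all distinct $\xi,\zeta\in Q$; (2) for every ball $B\subset X$ of radius at most $r_0$ there is $n_B\in\mathbb N$ such that for all $n\ge n_B$, $\mu\big(\bigcup_{\xi\in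 J_u(n)}B(\xi,\rho(u_{n-1}))\cap B\big)\ge\kappa\mu(B)$. $h$ is $u$-regular if there exist $n_0\in\mathbb N$ and $0<\lambda_1<\lambda_2<1$ such that for all $n\ge n_0$: $\lambda_1h(u_n)\le h(u_{n+1})\le\lambda_2h(u_n)$, and $h(x)\le x$ for all $x\le u_n$. *)

(* Defs.v *)
From HB Require Import structures.
From mathcomp Require Import all_boot all_order all_algebra.
From mathcomp Require Import all_classical all_reals all_analysis.

Set Implicit Arguments.
Unset Strict Implicit.
Unset Printing Implicit Defensive.

Import Order.TTheory GRing.Theory Num.Theory.
Import numFieldNormedType.Exports.

Local Open Scope classical_set_scope.
Local Open Scope ring_scope.

(* Functions R^+ -> R^+, with R^+ = ]0, +oo[, are represented by total functions
   R -> R; only their values at positive reals are ever constrained or used. *)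
Definition pos_fun (R : realType) (f : R -> R) : Prop :=
  forall x, 0 < x -> 0 < f x.

Definition pos_nondecreasing (R : realType) (f : R -> R) : Prop :=
  forall x y, 0 < x -> x <= y -> f x <= f y.

(* The library's measurable spaces are pointed; a space carrying a probability
   measure is nonempty, so asking for a point is no restriction. *)
#[short(type="pmetricType")]
HB.structure Definition PointedMetric (K : numDomainType) :=
  { M of Metric K M & Pointed M }.

Notation borel X := (g_sigma_algebraType (@open X)).

(* An infimum over all finite or countable covers by (open) balls: the balls are
   indexed by an arbitrary D : set nat. *)
Definition hausdorff_premeasure (R : realType) (X : metricType R) (s e : R)
    (A : set X) : \bar R :=
  ereal_inf [set v | exists (D : set nat) (x : nat -> X) (r : nat -> R),
    [/\ forall i, D i -> 0 < r i <= e,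
        A `<=` \bigcup_(i in D) ball (x i) (r i) &
        v = \esum_(i in D) (r i `^ s)%:E]].

Definition hausdorff_measure (R : realType) (X : metricType R) (s : R)
    (A : set X) : \bar R :=
  lim (hausdorff_premeasure s e A @[e --> 0^'+]).

Definition annulus (R : realType) (X : metricType R) (x : X) (r1 r2 : R) : set X :=
  ball x r2 `\` ball x r1.

Definition non_atomic (d : measure_display) (T : measurableType d) (R : realType)
    (mu : set T -> \bar R) : Prop :=
  forall A, measurable A -> (0 < mu A)%E ->
    exists B, [/\ measurable B, B `<=` A, (0 < mu B)%E & (mu B < mu A)%E].

Definition delta_regular (R : realType) (X : metricType R)
    (mu : set X -> \bar R) (delta r0 a b : R) : Prop :=
  forall (x : X) (r1 r2 : R), 0 < r1 -> r1 < r2 -> r2 <= r0 ->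
    [/\ ((a * r1 `^ delta)%:E <= mu (ball x r1))%E,
        (mu (ball x r1) <= (b * r1 `^ delta)%:E)%E &
        ((a * (r2 - r1) `^ delta)%:E <= mu (annulus x r1 r2))%E].

(* Rad xi stands for R_xi; its values outside Q are irrelevant. As Rad takes
   positive values, M ranges over the positive reals: for M <= 0 the set
   below would be Q itself. *)
Definition is_system (R : realType) (X : metricType R) (Q : set X)
    (Rad : X -> R) : Prop :=
  [/\ countable Q,
      forall xi, Q xi -> 0 < Rad xi &
      forall M, 0 < M -> finite_set [set xi | Q xi /\ M <= Rad xi]].

Definition W_set (R : realType) (X : metricType R) (Q : set X) (Rad : X -> R)
    (phi : R -> R) : set X :=
  [set x | infinite_set [set xi | Q xi /\ mdist x xi < phi (Rad xi)]].

Definition E_set (R : realType) (X : metricType R) (Q : set X) (Rad : X -> R)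
    (phi : R -> R) : set X :=
  W_set Q Rad phi `\`
  \bigcup_(e in [set e : R | 0 < e < 1]) W_set Q Rad (fun x => (1 - e) * phi x).

(* Meant for n >= 1; J_set Q Rad u 0 is empty since 0.-1 = 0 by convention. *)
Definition J_set (R : realType) (X : metricType R) (Q : set X) (Rad : X -> R)
    (u : nat -> R) (n : nat) : set X :=
  [set xi | Q xi /\ u n <= Rad xi < u n.-1].

(* The ball of radius r around x is given by the pair (x, r), and n_B may
   depend on that pair. *)
Definition well_distributed (R : realType) (X : metricType R)
    (mu : set X -> \bar R) (r0 : R) (Q : set X) (Rad : X -> R)
    (rho : R -> R) (u : nat -> R) : Prop :=
  exists c kappa : R,
    [/\ 0 < c < 1, 0 < kappa < 1,
        forall xi zeta, Q xi -> Q zeta -> xi <> zeta ->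
          c * Num.min (Rad xi) (Rad zeta) <= mdist xi zeta &
        forall (x : X) (r : R), 0 < r -> r <= r0 ->
          exists nB : nat, forall n, (nB <= n)%N ->
            (kappa%:E * mu (ball x r) <=
             mu ((\bigcup_(xi in J_set Q Rad u n) ball xi (rho (u n.-1)))
                 `&` ball x r))%E].

Definition u_regular (R : realType) (u : nat -> R) (h : R -> R) : Prop :=
  exists (n0 : nat) (l1 l2 : R),
    [/\ 0 < l1, l1 < l2, l2 < 1 &
        forall n, (n0 <= n)%N ->
          l1 * h (u n) <= h (u n.+1) <= l2 * h (u n) /\
          forall x, 0 < x -> x <= u n -> h x <= x].

(* Main.v *)
(** If G > 0 the terms g (u_n) do not tend to 0, so in both parts their sum
    diverges, and this alone is used. Let countably many balls B_i of radii
    r_i <= eps satisfy sum r_i^s <= W. A point of E outside all of them is the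
    limit of nested balls, the k-th one inside the annulus
    (1 - 1/(k+1)) phi(R_xi) <= d(., xi) < phi(R_xi) around some xi in Q.

    Inside a ball of radius r, the convergence of sum (phi(R)/R)^delta makes the
    balls B(zeta, phi(R_zeta)) with R_zeta = O(r) fill only a small portion, so
    on every deep level n at least c (r/rho(u_n))^delta points xi of J_u(n) stay
    clear of them. For the next ball we need such a xi for which B(xi, phi(R_xi))
    meets no B_i with r_i >= phi(R_xi), and the smaller B_i that it meets have
    total mass sum r_i^s <= gamma phi(R_xi)^s. If all candidates on the levels
    n < N failed, summing over them with weights v_n <= phi(u_n)^s would give
    c r^delta V <= C (W + V sum r_i^delta) + W/gamma,
    where V = sum_n v_n rho(u_n)^-delta; as sum r_i^delta is small compared to
    r^delta, this is impossible for large V. *)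

Require Import Defs.
From HB Require Import structures.
From mathcomp Require Import all_boot all_order all_algebra.
From mathcomp Require Import all_classical all_reals all_analysis.
From mathcomp Require Import ring lra.

Set Implicit Arguments.
Unset Strict Implicit.
Unset Printing Implicit Defensive.

Import Order.TTheory GRing.Theory Num.Theory.
Import numFieldNormedType.Exports.

Local Open Scope classical_set_scope.
Local Open Scope ring_scope.

(** * Real powers *)

Section PowR.
Variables (R : realType).
Implicit Types x y d : R.

Lemma le_powR d x y : 0 <= d -> 0 <= x -> x <= y -> x `^ d <= y `^ d.
Proof.
by move=> d0 x0 xy; apply: ge0_ler_powR => //; rewrite nnegrE // (le_trans x0).
Qed.

Lemma powR_div d x y : 0 <= x -> 0 < y -> (x / y) `^ d = x `^ d / y `^ d.
Proof.
move=> x0 y0; have y1 : 0 < y^-1 by rewrite invr_gt0.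
rewrite powRM ?(ltW y1) //; congr (_ * _).
have yd : y `^ d != 0 by rewrite gt_eqF // powR_gt0.
apply: (mulfI yd); rewrite divff // -powRM ?ltW // divff ?powR1 //.
by rewrite gt_eqF.
Qed.

Lemma powRD_le d x y : 0 <= d -> 0 <= x -> 0 <= y ->
  (x + y) `^ d <= 2 `^ d * (x `^ d + y `^ d).
Proof.
move=> d0 x0 y0; wlog xy : x y x0 y0 / x <= y.
  move=> h; case: (leP x y) => [/h|/ltW /h]; first exact.
  by rewrite [y + x]addrC [y `^ d + _]addrC; apply.
apply: (@le_trans _ _ ((2 * y) `^ d)).
  by apply: le_powR => //; [exact: addr_ge0|lra].
by rewrite powRM //; apply: ler_wpM2l; rewrite ?powR_ge0 // lerDr powR_ge0.
Qed.

End PowR.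

(** * Volume and packing estimates in a regular space *)

Section Metric.
Variables (R : realType) (X : pmetricType R).

Lemma ballP (x y : X) (r : R) : ball x r y <-> mdist x y < r.
Proof. by rewrite (@ballEmdist R X). Qed.

Lemma open_mball (x : X) (r : R) : open (ball x r).
Proof.
rewrite openE => y /ballP xy.
have e0 : 0 < r - mdist x y by rewrite subr_gt0.
apply/nbhs_ballP; exists (r - mdist x y) => //= z /ballP yz; apply/ballP.
by have := metric_triangle x y z; lra.
Qed.

Lemma measurable_mball (x : X) (r : R) :
  measurable (ball x r : set (borel X)).
Proof. by apply: sub_sigma_algebra; exact: open_mball. Qed.

Definition balls (s : seq X) (e : R) : set X :=
  \big[setU/set0]_(z <- s) ball z e.

Lemma ballsP s e (y : X) :
  balls s e y <-> exists2 z, z \in s & ball z e y.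
Proof. by rewrite /balls -bigcup_seq. Qed.

Lemma measurable_balls s e : measurable (balls s e : set (borel X)).
Proof. by apply: bigsetU_measurable => i _; exact: measurable_mball. Qed.

Variables (mu : probability (borel X) R).

(** Real values let volume estimates be combined by linear arithmetic. *)
Definition rmu (A : set X) : R := fine (mu A).

Lemma rmuK (A : set (borel X)) : measurable A -> (rmu A)%:E = mu A.
Proof. by move=> mA; rewrite /rmu fineK // fin_num_measure. Qed.

Lemma le_rmu (A B : set X) : measurable (A : set (borel X)) ->
  measurable (B : set (borel X)) -> A `<=` B -> rmu A <= rmu B.
Proof.
move=> mA mB AB; rewrite -lee_fin !rmuK //.
by apply: (le_measure mu); rewrite ?inE.
Qed.

Lemma rmuU (A B : set X) : measurable (A : set (borel X)) ->
  measurable (B : set (borel X)) -> rmu (A `|` B) <= rmu A + rmu B.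
Proof.
move=> mA mB; rewrite -lee_fin EFinD !rmuK //; last exact: measurableU.
exact: (measureU2 mu).
Qed.

Lemma rmu0 : rmu set0 = 0.
Proof. by rewrite /rmu measure0. Qed.

Lemma rmu_le1 (A : set X) : measurable (A : set (borel X)) -> rmu A <= 1.
Proof. by move=> mA; rewrite -lee_fin rmuK // probability_le1. Qed.

Lemma rmu_ge0 (A : set X) : 0 <= rmu A.
Proof. by rewrite /rmu fine_ge0 // measure_ge0. Qed.

Lemma rmu_bigU (I : Type) (s : seq I) (F : I -> set X) :
  (forall i, measurable (F i : set (borel X))) ->
  rmu (\big[setU/set0]_(i <- s) F i) <= \sum_(i <- s) rmu (F i).
Proof.
move=> mF; elim: s => [|i s IH]; first by rewrite !big_nil rmu0.
rewrite !big_cons; apply: (le_trans (rmuU _ _)) => //; last by rewrite lerD2l.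
by apply: bigsetU_measurable => j _; exact: mF.
Qed.

Variables (delta r0 a b : R).
Hypotheses (delta_gt0 : 0 < delta) (r0_gt0 : 0 < r0) (a_gt0 : 0 < a) (b_gt0 : 0 < b).
Hypothesis mu_regular : @delta_regular R X mu delta r0 a b.

Lemma rmu_ball_ge (x : X) r : 0 < r -> r < r0 -> a * r `^ delta <= rmu (ball x r).
Proof.
move=> r_gt0 rr0; have [h _ _] := mu_regular x r_gt0 rr0 (lexx _).
by rewrite -lee_fin rmuK //; exact: measurable_mball.
Qed.

(** The lower bound on the measure of annuli is positive, which an empty annulus would violate. *)
Lemma annulus_nonempty (x : X) r1 r2 : 0 < r1 -> r1 < r2 -> r2 <= r0 ->
  exists y, r1 <= mdist x y < r2.
Proof.
move=> r10 r12 r20; have [_ _ h] := mu_regular x r10 r12 r20.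
have [//|ne] := pselect (exists y, r1 <= mdist x y < r2).
have e : annulus x r1 r2 = set0.
  rewrite -subset0 => y [/ballP y2 /ballP y1]; apply: ne; exists y.
  by rewrite y2 andbT leNgt; apply/negP.
move: h; rewrite e measure0 lee_fin leNgt mulr_gt0 // powR_gt0 //.
by rewrite subr_gt0.
Qed.

(** Regularity speaks only of radii up to [r0]. From [r0] on, the measure is at most 1, hence at
    most [(r / r0) ^ delta]; the second summand makes the upper bound valid at all radii. *)
Definition upper_const := b + (r0 `^ delta)^-1.

Lemma upper_const_gt0 : 0 < upper_const.
Proof. by rewrite addr_gt0 // invr_gt0 powR_gt0. Qed.

Lemma rmu_ball_le (x : X) r : 0 < r ->
  rmu (ball x r) <= upper_const * r `^ delta.
Proof.
move=> r_gt0; rewrite /upper_const mulrDl.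
have ? : 0 < r0 `^ delta by rewrite powR_gt0.
case: (ltP r r0) => rr0.
  have [_ h _] := mu_regular x r_gt0 rr0 (lexx _).
  rewrite -[leLHS]addr0 lerD //.
    by rewrite -lee_fin rmuK //; exact: measurable_mball.
  by rewrite mulr_ge0 ?invr_ge0 ?powR_ge0.
apply: (le_trans (rmu_le1 (measurable_mball _ _))).
rewrite -[leLHS]add0r lerD //; first by rewrite mulr_ge0 ?powR_ge0 // ltW.
by rewrite mulrC ler_pdivlMr // mul1r le_powR // ltW.
Qed.

Lemma rmu_balls_le s e : 0 < e ->
  rmu (balls s e) <= (size s)%:R * (upper_const * e `^ delta).
Proof.
move=> e0; apply: (le_trans (rmu_bigU _ _)) => [i|]; first exact: measurable_mball.
apply: (@le_trans _ _ (\sum_(i <- s) upper_const * e `^ delta)).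
  by apply: ler_sum => i _; exact: rmu_ball_le.
by rewrite big_const_seq count_predT iter_addr_0 mulr_natl.
Qed.

Lemma rmu_balls_ge s e : 0 < e -> e < r0 -> uniq s ->
  (forall z z', z \in s -> z' \in s -> z <> z' -> 2 * e <= mdist z z') ->
  (size s)%:R * (a * e `^ delta) <= rmu (balls s e).
Proof.
move=> e0 er0; elim: s => [|z s IH]; first by rewrite mul0r rmu_ge0.
move=> /=/andP[zs us] sep; rewrite /balls big_cons -/(balls s e).
have -> : rmu (ball z e `|` balls s e) = rmu (ball z e) + rmu (balls s e).
  apply: EFin_inj; rewrite EFinD !rmuK ?(measureU mu) //.
  - exact: measurable_mball.
  - exact: measurable_balls.
  - rewrite -subset0 => y [/ballP zy /ballsP[z' z's /ballP z'y]].
    have zz' : z <> z' by move=> zz'; rewrite zz' z's in zs.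
    have := sep z z' (mem_head _ _); rewrite inE z's orbT => /(_ isT zz').
    by have := metric_triangle z y z'; rewrite (metric_sym y z'); lra.
  - exact: measurable_balls.
  - exact: measurable_mball.
  - by apply: measurableU; [exact: measurable_mball|exact: measurable_balls].
rewrite -natr1 mulrDl mul1r addrC lerD ?rmu_ball_ge //.
by apply: IH => // z1 z2 z1s z2s; apply: sep; rewrite inE ?z1s ?z2s orbT.
Qed.

(** Packing: the balls of radius [c / 2 * h], half the separation, are disjoint and lie in the ball
    of radius [r + h] around [x]; compare volumes. *)
Lemma size_separated (c h r : R) (x : X) (s : seq X) :
  0 < c -> c < 1 -> 0 < h -> h < r0 -> 0 < r ->
  uniq s ->
  (forall z z', z \in s -> z' \in s -> z <> z' -> c * h <= mdist z z') ->
  (forall z, z \in s -> mdist x z < r) ->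
  (size s)%:R * h `^ delta <=
  upper_const / (a * (c / 2) `^ delta) * (r + h) `^ delta.
Proof.
move=> c0 c1 h0 hr0 rr0 us sep sx.
have e0 : 0 < c / 2 * h by rewrite mulr_gt0 // divr_gt0.
have eh : c / 2 * h < h by rewrite gtr_pMl //; lra.
have := @rmu_balls_ge s (c / 2 * h) e0 (lt_trans eh hr0) us.
have sep' z z' : z \in s -> z' \in s -> z <> z' -> 2 * (c / 2 * h) <= mdist z z'.
  by move=> zs zs' zz'; have := sep z z' zs zs' zz'; lra.
move=> /(_ sep') h1.
have h2 : rmu (balls s (c / 2 * h)) <= rmu (ball x (r + h)).
  apply: le_rmu; [exact: measurable_balls|exact: measurable_mball|].
  move=> y /ballsP[z zs /ballP zy]; apply/ballP.
  by have := sx z zs; have := metric_triangle x z y; lra.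
have h3 := @rmu_ball_le x (r + h) (addr_gt0 rr0 h0).
have := le_trans h1 (le_trans h2 h3).
rewrite powRM ?(ltW h0) //; last by rewrite divr_ge0 // ltW.
have k0 : 0 < a * (c / 2) `^ delta by rewrite mulr_gt0 // powR_gt0 // divr_gt0.
rewrite mulrAC ler_pdivlMr //.
by move=> h4; apply: le_trans h4; rewrite le_eqVlt; apply/orP; left; apply/eqP; ring.
Qed.

End Metric.

Lemma finite_uniq_seq (T : choiceType) (A : set T) : finite_set A ->
  exists s : seq T, uniq s /\ forall x, x \in s <-> A x.
Proof.
move=> /finite_seqP[s ->]; exists (undup s); split; first exact: undup_uniq.
by move=> x; rewrite mem_undup.
Qed.

(** * Tails of series, finite subsums and Abel summation *)

Section Series.
Variable R : realType.

(** Once a partial sum is within [tau] of the supremum of all of them, at most [tau] is left to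
    add. *)
Lemma bounded_series_tail (e : nat -> R) (B : R) (m1 : nat) :
  (forall n, 0 <= e n) -> (forall n, \sum_(m1 <= i < n) e i <= B) ->
  forall tau, 0 < tau -> exists M, forall n, \sum_(M <= i < n) e i <= tau.
Proof.
move=> e0 eB tau tau0.
pose E := [set \sum_(m1 <= i < n) e i | n in [set: nat]].
have supE : has_sup E.
  split; first by exists (\sum_(m1 <= i < m1) e i); exists m1.
  by exists B => _ [n _ <-].
have [_ [M _ <-] SM] := sup_adherent tau0 supE.
exists (maxn m1 M) => n.
case: (leqP n (maxn m1 M)) => [nM|/ltnW Mn]; first by rewrite big_geq // ltW.
have : \sum_(m1 <= i < n) e i <= sup E by apply: ub_le_sup; [case: supE|exists n].
rewrite (big_cat_nat (n := maxn m1 M)) ?leq_maxl //=.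
suff : \sum_(m1 <= i < M) e i <= \sum_(m1 <= i < maxn m1 M) e i by lra.
case: (leqP m1 M) => mM //.
by rewrite big_geq ?sumr_ge0 // ltnW.
Qed.

Lemma sum_le_esum (T : choiceType) (Q : set T) (f : T -> R) (l : seq T) :
  (forall x, Q x -> 0 <= f x) -> uniq l -> (forall x, x \in l -> Q x) ->
  ((\sum_(x <- l) f x)%:E <= \esum_(x in Q) (f x)%:E)%E.
Proof.
move=> f0 ul lQ; apply: esum_ge; exists [set` l].
  by split; [exact: finite_seq|move=> x /= xl; exact: lQ].
by rewrite -fsbig_seq // -sumEFin.
Qed.

Lemma esum_bounded (T : choiceType) (Q : set T) (f : T -> R) :
  (forall x, Q x -> 0 <= f x) -> (\esum_(x in Q) (f x)%:E < +oo)%E ->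
  exists B, forall l, uniq l -> (forall x, x \in l -> Q x) ->
    \sum_(x <- l) f x <= B.
Proof.
move=> f0 foo.
have e0 : (0 <= \esum_(x in Q) (f x)%:E)%E.
  by apply: esum_ge0 => x Qx; rewrite lee_fin f0.
exists (fine (\esum_(x in Q) (f x)%:E)) => l ul lQ.
by rewrite -lee_fin fineK ?ge0_fin_numE //; exact: sum_le_esum.
Qed.

Variables (f w : nat -> R) (th : R) (N : nat).
Hypotheses (f_ge0 : forall n, 0 <= f n) (f_anti : forall n, f n.+1 <= f n).

(* The weights v_n = f_n - f_{n+1}, with f cut off at N: since they telescope,
   those with f_n <= y sum to at most y although f need not decay, while by
   Abel summation they keep a fixed proportion of sum f_n w_n. *)
Definition cutoff n := if (n < N)%N then f n else 0.
Definition decrement n := cutoff n - cutoff n.+1.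

Let cutoff_ge0 n : 0 <= cutoff n.
Proof. by rewrite /cutoff; case: ifP. Qed.

Let cutoff_anti n : cutoff n.+1 <= cutoff n.
Proof.
rewrite /cutoff; case: ifP => [h|_]; first by rewrite ltnW.
by case: ifP.
Qed.

Lemma decrement_ge0 n : 0 <= decrement n.
Proof. by rewrite subr_ge0. Qed.

Lemma decrement_le n : decrement n <= f n.
Proof.
have : cutoff n <= f n by rewrite /cutoff; case: ifP.
by rewrite /decrement; have := cutoff_ge0 n.+1; lra.
Qed.

Lemma sum_decrement_le n1 y : 0 <= y ->
  \sum_(n1 <= n < N | f n <= y) decrement n <= y.
Proof.
move=> y0.
case: (leqP N n1) => [|/ltnW nN]; first by move=> h; rewrite big_geq.
(* Truncating at [y] keeps the decrements where [f n <= y], leaves nonnegative ones elsewhere, and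
   makes the telescoped sum at most [y]. *)
pose G n := Num.min y (cutoff n).
apply: (@le_trans _ _ (\sum_(n1 <= n < N) (G n - G n.+1))).
  rewrite big_mkcond /=; apply: ler_sum_nat => n /andP[_ nN1].
  have Fn : cutoff n = f n by rewrite /cutoff nN1.
  have := cutoff_anti n; rewrite /G /decrement -Fn => h.
  case: ifP => fy; first by rewrite !min_r // (le_trans h).
  by rewrite subr_ge0 le_min !ge_min lexx h orbT.
rewrite (telescope_sumr_eq (fun n => - G n)) //; last first.
  by move=> k _; rewrite opprK addrC.
have GN : 0 <= G N by rewrite le_min y0 cutoff_ge0.
by have : G n1 <= y; [rewrite ge_min lexx|lra].
Qed.

(** The sum is that of [cutoff n * w n] minus that of [cutoff n.+1 * w n]. As [cutoff N = 0], an
    index shift only drops a nonnegative first term, so the growth of [w] bounds the second sum by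
    [th] times the first. *)
Lemma sum_decrement_ge n1 : 0 <= th -> (forall n, 0 <= w n) ->
  (forall n, (n1 <= n)%N -> w n <= th * w n.+1) ->
  (1 - th) * \sum_(n1 <= n < N) f n * w n <=
  \sum_(n1 <= n < N) decrement n * w n.
Proof.
move=> th0 w0 wth; case: (leqP N n1) => [h|/ltnW n1N].
  by rewrite !big_geq ?mulr0.
have eF : \sum_(n1 <= n < N) f n * w n = \sum_(n1 <= n < N) cutoff n * w n.
  by apply: eq_big_nat => n /andP[_ nN]; rewrite /cutoff nN.
have tele : \sum_(n1 <= n < N) (cutoff n.+1 * w n.+1 - cutoff n * w n) =
    cutoff N * w N - cutoff n1 * w n1.
  by rewrite (telescope_sumr_eq (fun n => cutoff n * w n)).
have cN : cutoff N = 0 by rewrite /cutoff ltnn.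
have le2 : \sum_(n1 <= n < N) cutoff n.+1 * w n <=
    th * \sum_(n1 <= n < N) cutoff n.+1 * w n.+1.
  rewrite mulr_sumr; apply: ler_sum_nat => n /andP[nn _].
  by rewrite mulrCA; apply: ler_wpM2l; rewrite ?cutoff_ge0 // wth.
have -> : \sum_(n1 <= n < N) decrement n * w n =
    \sum_(n1 <= n < N) cutoff n * w n - \sum_(n1 <= n < N) cutoff n.+1 * w n.
  by rewrite -sumrB; apply: eq_bigr => n _; rewrite mulrBl.
move: tele; rewrite sumrB cN mul0r eF => tele.
have h : \sum_(n1 <= n < N) cutoff n.+1 * w n.+1 <= \sum_(n1 <= n < N) cutoff n * w n.
  by have := mulr_ge0 (cutoff_ge0 n1) (w0 n1); lra.
by have := ler_wpM2l th0 h; lra.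
Qed.

End Series.

(** * Unbounded partial sums from divergence or from a positive upper limit *)

Section Divergence.
Variables (R : realType) (g : nat -> R).
Hypothesis g_ge0 : forall n, 0 <= g n.

Lemma series_unbounded : (\sum_(1 <= n <oo) (g n)%:E = +oo)%E ->
  forall n1 A, exists N, A <= \sum_(n1 <= n < N) g n.
Proof.
move=> goo n1 A; apply: contrapT => nex.
have bnd N : \sum_(n1 <= n < N) g n <= A.
  by rewrite leNgt; apply/negP => h; apply: nex; exists N; exact: ltW.
suff : ((+oo : \bar R) <= (\sum_(0 <= n < n1) g n + A)%:E)%E by rewrite leye_eq.
rewrite -goo; apply: lime_le; first by apply: is_cvg_nneseries => n _ _; rewrite lee_fin.
near=> N.
rewrite sumEFin lee_fin; apply: (@le_trans _ _ (\sum_(0 <= n < N) g n)).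
  by rewrite [leRHS]big_ltn ?lerDr //; near: N; exact: nbhs_infty_gt.
rewrite (big_cat_nat (n := n1)) //=; last by near: N; exact: nbhs_infty_ge.
by rewrite lerD2l.
Unshelve. all: by end_near. Qed.

(** Bounded partial sums have small tails, so the terms would tend to 0 and their upper limit would
    vanish. *)
Lemma limsup_unbounded : (0 < limn_esup (fun n => (g n)%:E))%E ->
  forall n1 A, exists N, A <= \sum_(n1 <= n < N) g n.
Proof.
move=> G0 n1 A; apply: contrapT => nex.
have bnd N : \sum_(n1 <= n < N) g n <= A.
  by rewrite leNgt; apply/negP => h; apply: nex; exists N; exact: ltW.
have g0 : (fun n => (g n)%:E) @ \oo --> 0%E.
  apply/fine_cvgP; split; first by near=> n.
  apply/cvgrPdist_le => e e0; have [M MP] := bounded_series_tail g_ge0 bnd e0.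
  exists M => // n /= Mn; rewrite sub0r normrN ger0_norm //.
  apply: le_trans (MP n.+1); rewrite big_nat_recr //= lerDr.
  exact: sumr_ge0.
by move: G0; rewrite (cvg_limn_einf_sup g0).2 ltxx.
Unshelve. all: by end_near. Qed.

End Divergence.

(** A cover by small balls of total mass below [W] would miss a point of [A], so the premeasure is
    at least [W] at small scales. Bounding all finite partial sums avoids extended reals from here
    on. *)
Lemma hausdorff_measure_infty (R : realType) (X : metricType R) (s : R) (A : set X) :
  (forall W, exists e, 0 < e /\
    forall (D : pred nat) (xx : nat -> X) (rr : nat -> R),
      (forall i, D i -> 0 < rr i <= e) ->
      (forall m, \sum_(0 <= i < m | D i) rr i `^ s <= W) ->
    exists x, A x /\ forall i, D i -> ~ ball (xx i) (rr i) x) ->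
  hausdorff_measure s A = +oo%E.
Proof.
move=> h; apply: cvg_lim => //; apply/cvgeyPge => W.
have [e [e0 eP]] := h W.
near=> d; apply: le_ereal_inf_tmp => _ [D [xx [rr [Drr cov ->]]]].
rewrite leNgt; apply/negP => lt.
have [|m|x [Ax nx]] := eP (fun i => `[< D i >]) xx rr.
- move=> i /asboolP /Drr /andP[-> /=] /le_trans; apply.
  by near: d; exact: nbhs_right_le.
- rewrite -lee_fin; apply: le_trans (ltW lt); rewrite -big_filter.
  apply: sum_le_esum; first by move=> i _; exact: powR_ge0.
    by rewrite filter_uniq // iota_uniq.
  by move=> i; rewrite mem_filter => /andP[/asboolP].
- have [i Di xi] := cov x Ax.
  by apply: (nx i) => //; apply/asboolP.
Unshelve. all: by end_near. Qed.

(** * Levels of the system and the convergent series along them *)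

Section Approximation.
Variables (R : realType) (X : pmetricType R) (mu : probability (borel X) R).
Variables (delta r0 a b t : R) (u : nat -> R) (Q : set X) (Rad : X -> R).
Variables (rho phi : R -> R).
Hypotheses (delta_gt0 : 0 < delta) (r0_gt0 : 0 < r0) (a_gt0 : 0 < a) (b_gt0 : 0 < b).
Hypothesis mu_regular : @delta_regular R X mu delta r0 a b.
Hypotheses (t_gt0 : 0 < t) (t_lt1 : t < 1) (u_geometric : forall n, u n = t ^+ n).
Hypothesis QR_system : is_system Q Rad.
Hypothesis rho_pos : pos_fun rho.
Variables (c kappa : R).
Hypotheses (c_gt0 : 0 < c) (c_lt1 : c < 1) (kappa_gt0 : 0 < kappa).
Hypothesis separated : forall xi zeta, Q xi -> Q zeta -> xi <> zeta ->
  c * Num.min (Rad xi) (Rad zeta) <= mdist xi zeta.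
Hypothesis distributed : forall (x : X) (r : R), 0 < r -> r <= r0 ->
  exists nB : nat, forall n, (nB <= n)%N ->
    (kappa%:E * mu (ball x r) <=
     mu ((\bigcup_(xi in J_set Q Rad u n) ball xi (rho (u n.-1)))
         `&` ball x r))%E.
Variables (n0 : nat) (l1 l2 : R).
Hypotheses (l1_gt0 : 0 < l1) (l2_gt0 : 0 < l2) (l2_lt1 : l2 < 1).
Hypothesis rho_ratio : forall n, (n0 <= n)%N ->
  l1 * rho (u n) <= rho (u n.+1) <= l2 * rho (u n) /\
  forall x, 0 < x -> x <= u n -> rho x <= x.
Hypotheses (phi_pos : pos_fun phi) (phi_nondecreasing : pos_nondecreasing phi).
Hypothesis phi_cvg0 : phi x / x @[x --> 0^'+] --> 0.
Hypothesis phi_summable :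
  (\esum_(xi in Q) ((phi (Rad xi) / Rad xi) `^ delta)%:E < +oo)%E.

Let u_gt0 n : 0 < u n. Proof. by rewrite u_geometric exprn_gt0. Qed.

Let uS n : u n.+1 = t * u n. Proof. by rewrite !u_geometric exprS. Qed.

Let u_anti m n : (m <= n)%N -> u n <= u m.
Proof. by move=> mn; rewrite !u_geometric ler_wiXn2l // ltW. Qed.

Let u_small e : 0 < e -> exists N, forall n, (N <= n)%N -> u n < e.
Proof.
move=> e0.
have /cvgrPdist_lt /(_ e e0) [N _ NP] : GRing.exp t @ \oo --> (0 : R).
  by apply: cvg_expr; rewrite gtr0_norm.
exists N => n /NP /=; rewrite sub0r normrN u_geometric gtr0_norm //.
exact: exprn_gt0.
Qed.

Let u_le1 n : u n <= 1.
Proof. by rewrite -[leRHS](expr0 t) -u_geometric u_anti. Qed.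

Let Rad_gt0 xi : Q xi -> 0 < Rad xi.
Proof. by case: QR_system => _ h _; exact: h. Qed.

Lemma level_of z : 0 < z -> z < 1 -> exists m, (0 < m)%N /\ u m <= z < u m.-1.
Proof.
move=> z0 z1.
have ex : exists n, u n <= z by have [N /(_ N (leqnn _)) /ltW] := u_small z0; exists N.
case: (ex_minnP ex) => m mz mmin; exists m.
have m0 : (0 < m)%N.
  by rewrite lt0n; apply/negP => /eqP m0; move: mz; rewrite m0 u_geometric expr0 leNgt z1.
split=> //; rewrite mz /= ltNge; apply/negP => /mmin.
by rewrite leqNgt prednK // leqnn.
Qed.

Lemma phi_small e : 0 < e ->
  exists N, forall x, 0 < x -> x <= u N -> phi x <= e * x.
Proof.
move=> e0; have /cvgrPdist_le /(_ e e0) := phi_cvg0.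
move=> [d /= d0 dP]; have [N NP] := u_small d0.
exists N => x x0 xN; have := dP x; rewrite /ball_ /= sub0r normrN gtr0_norm //.
rewrite (le_lt_trans xN (NP N _)) // => /(_ isT x0).
rewrite sub0r normrN gtr0_norm ?divr_gt0 ?phi_pos //.
by rewrite ler_pdivrMr.
Qed.

Lemma J_finite n : finite_set (J_set Q Rad u n).
Proof.
case: QR_system => _ _ /(_ (u n) (u_gt0 n)); apply: sub_finite_set.
by move=> x [Qx /andP[h _]]; split.
Qed.

Lemma open_distributed n : open (\bigcup_(xi in J_set Q Rad u n) ball xi (rho (u n.-1))).
Proof. by apply: bigcup_open => i _; exact: open_mball. Qed.

(** Over an empty level the union of balls is empty, against its positive measure inside a test
    ball. *)
Lemma J_nonempty : exists m1, forall n, (m1 <= n)%N -> exists xi, J_set Q Rad u n xi.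
Proof.
have r0h : 0 < r0 / 2 by rewrite divr_gt0.
have [|nB nBP] := distributed (point : X) r0h; first by lra.
exists nB => n /nBP h.
have [//|ne] := pselect (exists xi, J_set Q Rad u n xi).
move: h; rewrite [X in mu (X `&` _)](_ : _ = set0); last first.
  by rewrite -subset0 => y [xi Jxi _]; apply: ne; exists xi.
rewrite set0I measure0 -rmuK; last exact: measurable_mball.
rewrite -EFinM lee_fin leNgt mulr_gt0 //.
by apply: lt_le_trans (rmu_ball_ge mu_regular _ _ _) => //; [rewrite mulr_gt0 // powR_gt0|lra].
Qed.

Lemma J_level m n xi : (0 < m)%N -> (0 < n)%N ->
  J_set Q Rad u m xi -> J_set Q Rad u n xi -> m = n.
Proof.
wlog mn : m n / (m <= n)%N.
  move=> h m0 n0' Jm Jn; case: (leqP m n) => [|/ltnW] mn; first exact: h.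
  by apply/esym/h.
move=> m0 n0' [_ /andP[h1 _]] [_ /andP[_ h2]].
apply/eqP; rewrite eqn_leq mn leqNgt; apply/negP => mn'.
have := u_anti (_ : (m <= n.-1)%N); rewrite -ltnS prednK // => /(_ mn').
lra.
Qed.

(** Deep levels are nonempty and disjoint, so one point per level gives a subfamily of the
    convergent sum. Term [m] is compared with the point [xi] of level [m.-1]: there
    [phi (u m.-1) <= phi (Rad xi)] and [Rad xi < u m.-2], and passing from [u m.-2] to [u m] costs
    [t ^+ 2]. *)
Lemma phi_ratio_tail tau : 0 < tau -> exists M, forall n,
  \sum_(M.+1 <= m < n) (phi (u m.-1) / u m) `^ delta <= tau.
Proof.
move=> tau0.
have [B BP] : exists B, forall s, uniq s -> (forall x, x \in s -> Q x) ->
    \sum_(x <- s) (phi (Rad x) / Rad x) `^ delta <= B.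
  by apply: esum_bounded => // x _; exact: powR_ge0.
have [m1 m1P] := J_nonempty.
have [xi xiP] := choice (fun n => m1P _ (leq_maxr n m1)).
pose e m := (phi (u m.-1) / u m) `^ delta.
have t2d : 0 < (t ^+ 2) `^ delta by rewrite powR_gt0 // exprn_gt0.
have eB n : \sum_((maxn 1 m1).+1 <= m < n) e m <= ((t ^+ 2) `^ delta)^-1 * B.
  pose s := map (fun m => xi m.-1) (index_iota (maxn 1 m1).+1 n).
  have Jxi m : m \in index_iota (maxn 1 m1).+1 n ->
      (0 < m.-1)%N /\ J_set Q Rad u m.-1 (xi m.-1).
    rewrite mem_index_iota gtn_max => /andP[/andP[m_1 mm1] _].
    have h : (m1 <= m.-1)%N by rewrite -ltnS prednK // (leq_trans _ m_1).
    split; first by rewrite -ltnS prednK // (leq_trans _ m_1).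
    by have := xiP m.-1; rewrite (maxn_idPl h).
  have us : uniq s.
    rewrite map_inj_in_uniq ?iota_uniq // => i j.
    move=> /[dup] ii /Jxi [i0 Ji] /[dup] jj /Jxi[j0 Jj] ij.
    rewrite -ij in Jj; have := J_level i0 j0 Ji Jj.
    move: ii jj; rewrite !mem_index_iota => /andP[ii _] /andP[jj _] e1.
    by rewrite -(prednK (leq_trans _ ii)) // e1 prednK // (leq_trans _ jj).
  rewrite ler_pdivlMl //; apply: le_trans (BP s us _); last first.
    by move=> x /mapP[m /Jxi[_ [Qx _]] ->].
  rewrite big_map mulr_sumr big_seq [leRHS]big_seq.
  apply: ler_sum => m /Jxi[m0 [Qx /andP[x1 x2]]].
  have Rx := Rad_gt0 Qx.
  have t2 : 0 <= t ^+ 2 by rewrite exprn_ge0 // ltW.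
  have um : 0 <= phi (u m.-1) / u m by rewrite divr_ge0 // ltW // phi_pos.
  rewrite -powRM //; apply: le_powR; [exact: ltW|exact: mulr_ge0|rewrite mulrA].
  have -> : u m = t ^+ 2 * u m.-2.
    by move: m0; case: (m) => [|[|k]] //= _; rewrite !uS expr2 mulrA.
  rewrite invfM mulrA [t ^+ 2 * _]mulrC mulfK ?expf_neq0 ?gt_eqF //.
  apply: ler_pM.
  - by rewrite ltW // phi_pos.
  - by rewrite invr_ge0 ltW.
  - exact: phi_nondecreasing.
  - by rewrite lef_pV2 ?posrE // ltW.
have [M MP] := bounded_series_tail (fun m => powR_ge0 (phi (u m.-1) / u m) delta) eB tau0.
exists M => n; apply: le_trans (MP n).
case: (ltnP M n) => Mn; last by rewrite !big_geq // leqW.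
by rewrite [leRHS]big_ltn // lerDr powR_ge0.
Qed.

(** * Packing on levels and abundance of clear points *)

Let bb := upper_const delta r0 b.
Let Cc := bb / (a * (c / 2) `^ delta).

Let bb_gt0 : 0 < bb. Proof. exact: upper_const_gt0. Qed.

Let Cc_gt0 : 0 < Cc.
Proof. by rewrite divr_gt0 // mulr_gt0 // powR_gt0 // divr_gt0. Qed.

Lemma size_near h (x : X) r (s : seq X) : 0 < h -> h < r0 -> 0 < r -> uniq s ->
  (forall z, z \in s -> [/\ Q z, h <= Rad z & mdist x z < r]) ->
  (size s)%:R * h `^ delta <= Cc * (r + h) `^ delta.
Proof.
move=> h0 hr0 r_gt0 us sP.
apply: (size_separated delta_gt0 r0_gt0 a_gt0 b_gt0 mu_regular (x := x)) => //.
- move=> z z' /sP[Qz hz _] /sP[Qz' hz' _] zz'.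
  apply: le_trans (separated Qz Qz' zz').
  by rewrite ler_pM2l // le_min hz hz'.
- by move=> z /sP[].
Qed.

(** The factor 2 is what [clear_hits] needs: a ball smaller than both [phi (Rad xi)] and
    [phi (Rad zeta)] cannot hit both points. *)
Definition clear (h : R) (xi : X) : Prop :=
  forall zeta, Q zeta -> zeta <> xi -> Rad xi <= Rad zeta -> Rad zeta < h ->
  2 * (phi (Rad xi) + phi (Rad zeta)) <= mdist xi zeta.

Let C2 := 4 + 4 / (c * t).

Let C2_gt0 : 0 < C2.
Proof. by rewrite addr_gt0 // divr_gt0 // mulr_gt0. Qed.

(** Since [phi (Rad xi) <= phi (Rad zeta)], the distance is below [4 * phi (Rad zeta)]. Separation
    then gives [c * Rad xi < 4 * phi (Rad zeta)], and [rho (u n.-1) <= u n / t <= Rad xi / t] yields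
    the constant [C2]. So the whole ball of radius [rho (u n.-1)] around [xi] lies in that of radius
    [C2 * phi (Rad zeta)] around [zeta]. *)
Lemma not_clear h xi n : (n0 < n)%N -> J_set Q Rad u n xi -> ~ clear h xi ->
  exists zeta, [/\ Q zeta, Rad xi <= Rad zeta, Rad zeta < h,
    mdist xi zeta < 4 * phi (Rad zeta) &
    4 * phi (Rad zeta) + rho (u n.-1) <= C2 * phi (Rad zeta)].
Proof.
move=> n0n [Qxi /andP[xi1 xi2]] ncl.
have [//|nex] := pselect (exists zeta, [/\ Q zeta, zeta <> xi, Rad xi <= Rad zeta,
  Rad zeta < h & mdist xi zeta < 2 * (phi (Rad xi) + phi (Rad zeta))]); last first.
  case: ncl => z Qz zxi z1 z2; rewrite leNgt; apply/negP => z3.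
  by apply: nex; exists z.
move=> [z [Qz zxi z1 z2 z3]]; exists z.
have pm := phi_nondecreasing (Rad_gt0 Qxi) z1.
have d4 : mdist xi z < 4 * phi (Rad z) by lra.
split => //.
have := separated Qxi Qz (nesym zxi); rewrite min_l // => sep.
have un : u n.-1 = u n / t.
  rewrite -[in RHS](prednK (leq_ltn_trans (leq0n _) n0n)) uS mulrC.
  by rewrite mulKf ?gt_eqF.
have rn : rho (u n.-1) <= u n.-1.
  have h1 : (n0 <= n.-1)%N by rewrite -ltnS prednK // (leq_ltn_trans (leq0n _) n0n).
  by have [_ ->] := rho_ratio h1.
rewrite /C2 [leRHS]mulrDl lerD2l; apply: (le_trans rn); rewrite un ler_pdivrMr //.
have -> : 4 / (c * t) * phi (Rad z) * t = (4 * phi (Rad z)) / c.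
  by field; rewrite !gt_eqF.
rewrite ler_pdivlMr //; apply: le_trans (ltW d4).
by apply: le_trans sep; rewrite mulrC ler_pM2l.
Qed.

(** The balls of level [n] fill a fixed proportion of the ball of radius [r / 2], and the balls of
    points that are not clear take up at most half of that. The latter is arranged through [rs], so
    [c1] does not depend on [K]. *)
Lemma many_clear : exists c1, 0 < c1 /\ forall K, 0 < K ->
  exists rs, 0 < rs /\ forall (x : X) r, 0 < r -> r <= rs ->
  exists n1, forall n, (n1 <= n)%N -> exists s : seq X,
    [/\ uniq s,
        forall xi, xi \in s ->
          [/\ J_set Q Rad u n xi, mdist x xi < 3 / 4 * r & clear (K * r) xi] &
        c1 * r `^ delta <= (size s)%:R * rho (u n) `^ delta].
Proof.
(* Half of the measure guaranteed in the ball of radius [r / 2], divided by [r ^ delta]. *)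
pose k0 := kappa * a * (1 / 2) `^ delta / 2.
have k0_gt0 : 0 < k0 by rewrite divr_gt0 // !mulr_gt0 // powR_gt0 // divr_gt0.
exists (k0 * l1 `^ delta / bb); split.
  by rewrite divr_gt0 // mulr_gt0 // powR_gt0.
move=> K K0.
pose A := Cc * (1 + K) `^ delta * bb * C2 `^ delta.
have K1 : 0 < (1 + K) `^ delta by rewrite powR_gt0 // addr_gt0.
have A_gt0 : 0 < A.
  exact: mulr_gt0 (mulr_gt0 (mulr_gt0 Cc_gt0 K1) bb_gt0) (powR_gt0 _ C2_gt0).
have [M MP] := phi_ratio_tail (divr_gt0 k0_gt0 A_gt0).
(* For [Rad zeta < K * r] this gives [4 * phi (Rad zeta) <= r / 4], so [zeta] is within [r] of [x]
   when [xi] is within [3 / 4 * r]. *)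
have [N NP] : exists N, forall x, 0 < x -> x <= u N -> phi x <= (16 * K)^-1 * x.
  by apply: phi_small; rewrite invr_gt0 mulr_gt0.
have [N2 N2P] := u_small r0_gt0.
pose M' := maxn (maxn M N) N2.
(* The bound [K * r <= u M'.+1] puts every [zeta] with [Rad zeta < K * r] on a level of index above
   [M], where the tail is small. *)
exists (Num.min (u M'.+1 / K) (r0 / 2)); split.
  by rewrite lt_min !divr_gt0.
move=> x r r_gt0; rewrite le_min => /andP[rK rr0].
have Kr : K * r <= u M'.+1 by rewrite mulrC -ler_pdivlMr.
have r2 : 0 < r / 2 by rewrite divr_gt0.
have [|nB nBP] := distributed x r2; first by lra.
have r4 : 0 < r / 4 by rewrite divr_gt0.
have [N3 N3P] := u_small r4.
exists (maxn (maxn nB n0) N3).+1 => n nn.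
have [n0n nBn N3n] : [/\ (n0 < n)%N, (nB <= n)%N & (N3 <= n.-1)%N].
  move: nn; rewrite !gtn_max => /andP[/andP[h1 h2] h3]; split => //; first exact: ltnW.
  by rewrite -ltnS prednK // (leq_ltn_trans _ h3).
have npos : (0 < n)%N by rewrite (leq_ltn_trans _ n0n).
have n0n1 : (n0 <= n.-1)%N by rewrite -ltnS prednK.
have rho4 : rho (u n.-1) < r / 4.
  by have [_ h] := rho_ratio n0n1; apply: le_lt_trans (h _ _ _) (N3P _ N3n).
have rho_gt0 : 0 < rho (u n.-1) by exact: rho_pos.
have [s [us sP]] : exists s : seq X, uniq s /\ forall xi, xi \in s <->
    (J_set Q Rad u n xi /\ mdist x xi < 3 / 4 * r) /\ clear (K * r) xi.
  apply: finite_uniq_seq; apply: sub_finite_set (J_finite n).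
  by move=> xi [[]].
exists s; split=> //; first by move=> xi /sP[[]].
have [S SP] : {S : nat -> seq X & forall m, uniq (S m) /\ forall z, z \in S m <->
    J_set Q Rad u m z /\ mdist x z < r /\ Rad z < K * r}.
  apply: (@choice _ _ (fun m (sm : seq X) => uniq sm /\ forall z, z \in sm <->
    J_set Q Rad u m z /\ mdist x z < r /\ Rad z < K * r)) => m.
  by apply: finite_uniq_seq; apply: sub_finite_set (J_finite m) => xi [].
(* On level [m] this dominates every [C2 * phi (Rad zeta)]. *)
pose e m := C2 * phi (u m.-1).
have e_gt0 m : 0 < e m by rewrite mulr_gt0 // phi_pos.
pose bad := \big[setU/set0]_(M.+1 <= m < n.+1) balls (S m) (e m).
have bad_le : rmu mu bad <= k0 * r `^ delta.
  apply: (le_trans (rmu_bigU _ _ _)) => [i|]; first exact: measurable_balls.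
  apply: (@le_trans _ _ (\sum_(M.+1 <= m < n.+1)
      A * r `^ delta * (phi (u m.-1) / u m) `^ delta)).
    apply: ler_sum => m _.
    apply: (le_trans (rmu_balls_le delta_gt0 r0_gt0 b_gt0 mu_regular _ (e_gt0 m))).
    have um0 : 0 < u m `^ delta by rewrite powR_gt0.
    have ph0 : 0 <= phi (u m.-1) by rewrite ltW // phi_pos.
    have cnt : (size (S m))%:R * u m `^ delta <= Cc * ((1 + K) `^ delta * r `^ delta).
      have [uS' S'P] := SP m.
      (* A member [z0] gives [u m <= Rad z0 < K * r], hence [u m < r0] and [r + u m <= (1 + K) * r];
         without members there is nothing to count. *)
      case E : (S m) => [|z0 s0].
        rewrite mul0r; apply: mulr_ge0 (ltW Cc_gt0) _.
        exact: mulr_ge0 (powR_ge0 _ _) (powR_ge0 _ _).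
      have z0S : z0 \in S m by rewrite E mem_head.
      have /S'P[[Qz0 /andP[z1 _]] [_ z2]] := z0S.
      have umK : u m <= K * r by lra.
      rewrite -E; apply: le_trans (size_near (x := x) (r := r) _ _ _ _ _) _ => //.
      - apply: le_lt_trans umK (le_lt_trans Kr (N2P _ _)).
        by rewrite leqW // leq_maxr.
      - by move=> z /S'P[[Qz /andP[z3 _]] [z4 _]].
      rewrite -powRM ?(ltW r_gt0) ?addr_ge0 ?(ltW K0) //.
      rewrite ler_pM2l //; apply: le_powR; rewrite ?(ltW delta_gt0) //.
        by rewrite addr_ge0 ?ltW.
      by lra.
    rewrite /e (powRM _ (ltW C2_gt0) ph0) (powR_div _ ph0 (u_gt0 m)).
    rewrite /A [leRHS]mulrA -/bb ler_pdivlMr //.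
    have -> : (size (S m))%:R * (bb * (C2 `^ delta * phi (u m.-1) `^ delta)) * u m `^ delta =
      (size (S m))%:R * u m `^ delta * (bb * C2 `^ delta * phi (u m.-1) `^ delta) by ring.
    have -> : Cc * (1 + K) `^ delta * bb * C2 `^ delta * r `^ delta * phi (u m.-1) `^ delta =
      Cc * ((1 + K) `^ delta * r `^ delta) * (bb * C2 `^ delta * phi (u m.-1) `^ delta) by ring.
    apply: ler_wpM2r cnt; apply: mulr_ge0 (powR_ge0 _ _).
    exact: mulr_ge0 (ltW bb_gt0) (powR_ge0 _ _).
  rewrite -mulr_sumr -mulrA mulrCA [leRHS]mulrC; apply: ler_wpM2l; first exact: powR_ge0.
  by rewrite mulrC -ler_pdivlMr.
have wd := nBP _ nBn.
have mbad : measurable (bad : set (borel X)).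
  by apply: bigsetU_measurable => m _; exact: measurable_balls.
pose U := \bigcup_(xi in J_set Q Rad u n) ball xi (rho (u n.-1)).
have mU : measurable (U `&` ball x (r / 2) : set (borel X)).
  apply: measurableI; [|exact: measurable_mball].
  by apply: sub_sigma_algebra; exact: open_distributed.
have wd' : kappa * rmu mu (ball x (r / 2)) <= rmu mu (U `&` ball x (r / 2)).
  by rewrite -lee_fin EFinM !rmuK //; exact: measurable_mball.
(* The centre [xi] is within [r / 2 + r / 4] of [x]. If it is not clear, [not_clear] gives a [z] of
   level between [M.+1] and [n] whose enlarged ball contains the point. *)
have sub : U `&` ball x (r / 2) `<=` balls s (rho (u n.-1)) `|` bad.
  move=> y [[xi Jxi /ballP xiy] /ballP xy].
  have dxi : mdist x xi < 3 / 4 * r.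
    by have := metric_triangle x y xi; rewrite (metric_sym y xi); lra.
  have [cl|ncl] := pselect (clear (K * r) xi).
    by left; apply/ballsP; exists xi; [apply/sP|apply/ballP].
  right; have [z [Qz z1 z2 z3 z4]] := not_clear n0n Jxi ncl.
  have zM : Rad z < u M'.+1 by exact: lt_le_trans Kr.
  have [m [m0 /andP[m1 m2]]] := level_of (Rad_gt0 Qz) (lt_le_trans zM (u_le1 _)).
  have [_ /andP[xi1 _]] := Jxi.
  have Mm : (M < m)%N.
    rewrite ltnNge; apply/negP => mM.
    have : (m <= M'.+1)%N by rewrite (leq_trans mM) // leqW // /M' !leq_max leqnn.
    by move=> /u_anti; lra.
  have mn : (m < n.+1)%N.
    rewrite ltnNge; apply/negP => nm.
    have : (n <= m.-1)%N by rewrite -ltnS prednK.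
    by move=> /u_anti; lra.
  have phz : phi (Rad z) <= r / 16.
    have := NP _ (Rad_gt0 Qz); rewrite (le_trans (ltW zM)) ?u_anti //.
      move=> /(_ isT) h; apply: (le_trans h); rewrite invfM.
      rewrite mulrC mulrA ler_pdivrMr // [leRHS]mulrAC ler_pdivlMr // ?mulrV ?unitfE //.
      by rewrite -mulrA mulVf ?mulr1 // ltW // mulrC.
    by rewrite leqW // /M' !leq_max leqnn orbT.
  rewrite /bad -bigcup_seq; exists m; first by rewrite /= mem_index_iota Mm mn.
  apply/ballsP; exists z.
    apply (SP m).2; split; first by split => //; rewrite m1 m2.
    by split => //; have := metric_triangle x xi z; lra.
  apply/ballP; apply: (@lt_le_trans _ _ (C2 * phi (Rad z))).
    by have := metric_triangle z xi y; rewrite (metric_sym z xi); lra.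
  by rewrite /e ler_pM2l //; apply: phi_nondecreasing; [exact: Rad_gt0|exact: ltW].
have mbs : measurable (balls s (rho (u n.-1)) : set (borel X)) by exact: measurable_balls.
have h1 := le_rmu mu mU (measurableU _ _ mbs mbad) sub.
have h2 := rmuU mu mbs mbad.
have h3 := rmu_balls_le delta_gt0 r0_gt0 b_gt0 mu_regular s rho_gt0.
have r2r0 : r / 2 < r0 by lra.
have h4 := rmu_ball_ge mu_regular x r2 r2r0.
have h5 : 2 * k0 * r `^ delta <= kappa * rmu mu (ball x (r / 2)).
  have -> : 2 * k0 * r `^ delta = kappa * (a * (r / 2) `^ delta).
    have -> : (r / 2) `^ delta = (1 / 2) `^ delta * r `^ delta.
      by rewrite -powRM ?(ltW r_gt0) //; congr (_ `^ _); lra.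
    by rewrite /k0; field.
  by rewrite ler_pM2l.
have h6 : k0 * r `^ delta <= (size s)%:R * (bb * rho (u n.-1) `^ delta).
  by rewrite /bb; lra.
have [/andP[h7 _] _] := rho_ratio n0n1; rewrite prednK // in h7.
have h8 : l1 `^ delta * rho (u n.-1) `^ delta <= rho (u n) `^ delta.
  rewrite -powRM ?(ltW l1_gt0) ?(ltW rho_gt0) //.
  by apply: le_powR => //; rewrite ltW // mulr_gt0.
have l1d : 0 <= l1 `^ delta / bb by rewrite divr_ge0 ?powR_ge0 // ltW.
have := ler_wpM2r l1d h6.
have -> : k0 * r `^ delta * (l1 `^ delta / bb) = k0 * l1 `^ delta / bb * r `^ delta by ring.
move=> h9; apply: (le_trans h9).
have -> : (size s)%:R * (bb * rho (u n.-1) `^ delta) * (l1 `^ delta / bb) =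
  (size s)%:R * (l1 `^ delta * rho (u n.-1) `^ delta).
  by field; rewrite gt_eqF.
by rewrite ler_wpM2l.
Qed.

(** * Weighted count of the candidates hit by a single ball *)

Variable s : R.
Hypotheses (s_gt0 : 0 < s) (s_lt : s < delta).
Hypothesis divergent : forall n1 A, exists N,
  A <= \sum_(n1 <= n < N) phi (u n) `^ s / rho (u n) `^ delta.

Let f n := phi (u n) `^ s.
Let w n := (rho (u n) `^ delta)^-1.

Let f_ge0 n : 0 <= f n. Proof. exact: powR_ge0. Qed.

Let f_anti n : f n.+1 <= f n.
Proof.
apply: le_powR; [exact: ltW|by rewrite ltW // phi_pos|].
by apply: phi_nondecreasing => //; exact: u_anti.
Qed.

Let w_ge0 n : 0 <= w n. Proof. by rewrite invr_ge0 powR_ge0. Qed.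

Let w_ge n : (n0 <= n)%N -> 1 <= u n `^ delta * w n.
Proof.
move=> n0n; have [_ /(_ (u n)) h] := rho_ratio n0n.
have rn : 0 < rho (u n) by exact: rho_pos.
rewrite ler_pdivlMr ?powR_gt0 // mul1r; apply: le_powR; [exact: ltW|exact: ltW|].
exact: h.
Qed.

(** One factor comes from splitting [(2 * e + u n) ^ delta], the other from the 2 in front of
    [e]. *)
Let C3 := Cc * (2 `^ delta * 2 `^ delta).

Let C3_gt0 : 0 < C3.
Proof. by apply: mulr_gt0 Cc_gt0 _; rewrite mulr_gt0 // powR_gt0. Qed.

Lemma count_near n (y : X) e (S : seq X) : u n < r0 -> 0 < e -> uniq S ->
  (forall xi, xi \in S -> J_set Q Rad u n xi /\ mdist y xi < 2 * e) ->
  (size S)%:R * u n `^ delta <= C3 * (u n `^ delta + e `^ delta).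
Proof.
move=> ur e0 uS' SP; have ee0 : 0 < 2 * e by rewrite mulr_gt0.
apply: le_trans (size_near (x := y) (r := 2 * e) _ ur _ uS' _) _ => //.
  by move=> z /SP[[Qz /andP[z1 _]] z2].
rewrite /C3 -mulrA ler_pM2l // -mulrA.
apply: le_trans (powRD_le (ltW delta_gt0) (ltW ee0) (ltW (u_gt0 n))) _.
rewrite ler_pM2l ?powR_gt0 // powRM ?(ltW e0) // addrC mulrDr lerD2r.
rewrite ler_peMl ?powR_ge0 //.
have h12 : 1 <= 2 :> R by lra.
by rewrite -[leLHS](powRr0 2); apply: (ler_powR h12); exact: ltW.
Qed.

(** Necessary for the ball of radius [e] around [y] to meet that of radius [phi (Rad xi)] around
    [xi]. *)
Definition hits (y : X) (e : R) (xi : X) := mdist y xi < e + phi (Rad xi).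

Lemma clear_hits (h : R) (y xi zeta : X) (e : R) : clear h xi -> Q zeta ->
  zeta <> xi -> Rad xi <= Rad zeta -> Rad zeta < h ->
  hits y e xi -> hits y e zeta -> e < phi (Rad xi) -> e < phi (Rad zeta) -> False.
Proof.
move=> cl Qz zxi z1 z2; have := cl _ Qz zxi z1 z2.
by have := metric_triangle xi y zeta; rewrite (metric_sym xi y) /hits; lra.
Qed.

Section Levels.
Variables (n1 N : nat) (S : nat -> seq X).
Hypothesis n0n1 : (n0 <= n1)%N.
Hypothesis n1_gt0 : (0 < n1)%N.
Hypothesis u_n1 : u n1 < r0.
Hypothesis S_uniq : forall n, (n1 <= n)%N -> uniq (S n).
Hypothesis S_J : forall n xi, (n1 <= n)%N -> xi \in S n -> J_set Q Rad u n xi.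

Let v := decrement f N.
Let V := \sum_(n1 <= n < N) v n * w n.

Let v_ge0 n : 0 <= v n. Proof. exact: decrement_ge0. Qed.

(** The candidates counted lie within [2 * e] of [y], so level [n] has at most
    [C3 * (1 + e ^ delta * w n)] of them, and none unless [f n <= e ^ s]. The weights of the levels
    with [f n <= e ^ s] sum to at most [e ^ s]. *)
Lemma large_hits_weight (y : X) e : 0 < e ->
  \sum_(n1 <= n < N) \sum_(xi <- S n | hits y e xi && (phi (Rad xi) <= e)) v n <=
  C3 * (e `^ s + e `^ delta * V).
Proof.
move=> e0.
apply: (@le_trans _ _ (\sum_(n1 <= n < N)
    C3 * ((if f n <= e `^ s then v n else 0) + e `^ delta * (v n * w n)))).
  apply: ler_sum_nat => n /andP[n1n _].
  rewrite -big_filter big_const_seq count_predT iter_addr_0 -mulr_natl.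
  set S' := seq.filter _ _.
  case E : S' => [|z0 s0].
    rewrite mul0r; apply: mulr_ge0 (ltW C3_gt0) _.
    apply: addr_ge0; first by case: ifP.
    exact: mulr_ge0 (powR_ge0 _ _) (mulr_ge0 (v_ge0 n) (w_ge0 n)).
  have z0S : z0 \in S' by rewrite E mem_head.
  have fe : f n <= e `^ s.
    move: z0S; rewrite mem_filter => /andP[/andP[_ pe] /(S_J n1n)[_ /andP[z1 _]]].
    apply: le_powR; [exact: ltW|by rewrite ltW // phi_pos|].
    by apply: le_trans pe; exact: phi_nondecreasing.
  rewrite -E fe.
  have unr0 : u n < r0 by apply: le_lt_trans u_n1; exact: u_anti.
  have uS' : uniq S' by rewrite filter_uniq // S_uniq.
  have cnt : (size S')%:R * u n `^ delta <= C3 * (u n `^ delta + e `^ delta).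
    apply: (count_near (y := y)) => // xi; rewrite mem_filter => /andP[/andP[h1 h2] h3].
    by split; [exact: S_J|move: h1; rewrite /hits; lra].
  have wn := w_ge (leq_trans n0n1 n1n).
  have un0 : 0 < u n `^ delta by rewrite powR_gt0.
  have sz : (size S')%:R <= C3 * (1 + e `^ delta * w n).
    rewrite -(ler_pM2r un0); apply: (le_trans cnt).
    rewrite -[leRHS]mulrA (ler_pM2l C3_gt0) [leRHS]mulrDl mul1r lerD2l.
    by rewrite -mulrA ler_peMr ?powR_ge0 // mulrC.
  apply: le_trans (ler_wpM2r (v_ge0 n) sz) _.
  by rewrite le_eqVlt; apply/orP; left; apply/eqP; ring.
rewrite -mulr_sumr (ler_pM2l C3_gt0) big_split /= -mulr_sumr -/V lerD2r.
rewrite -big_mkcond; apply: sum_decrement_le => //; exact: powR_ge0.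
Qed.

Variable h : R.
Hypothesis u_h : u n1.-1 < h.
Hypothesis S_clear : forall n xi, (n1 <= n)%N -> xi \in S n -> clear h xi.

Let P := [seq (n, xi) | n <- index_iota n1 N, xi <- S n].

Let P_uniq : uniq P.
Proof.
apply: allpairs_uniq_dep => //=; first exact: iota_uniq.
- by move=> n; rewrite mem_index_iota => /andP[h1 _]; exact: S_uniq.
- by move=> [n1' x1] [n2' x2] _ _ /= [-> ->].
Qed.

Let P_mem p : p \in P -> (n1 <= p.1)%N /\ p.2 \in S p.1.
Proof.
by move=> /allpairsPdep[n [xi [nN xiS ->]]] /=; move: nN; rewrite mem_index_iota => /andP[].
Qed.

(** Of two points hit, the one with the smaller [Rad] is clear, which [clear_hits] excludes. One
    point cannot be counted twice because levels are disjoint. *)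
Lemma small_hits_unique (y : X) e :
  \sum_(n1 <= n < N) \sum_(xi <- S n | hits y e xi && (e < phi (Rad xi))) 1 <= 1 :> R.
Proof.
have -> : \sum_(n1 <= n < N) \sum_(xi <- S n | hits y e xi && (e < phi (Rad xi))) 1 =
    \sum_(p <- P | hits y e p.2 && (e < phi (Rad p.2))) 1 :> R.
  rewrite [RHS]big_mkcond big_allpairs_dep /=.
  by apply: eq_bigr => n _; rewrite big_mkcond.
rewrite -big_filter big_const_seq count_predT iter_addr_0 -[leRHS]/(1%:R) ler_nat.
set P' := seq.filter _ _; have uP' : uniq P' by rewrite filter_uniq.
have P'P p : p \in P' -> [/\ (n1 <= p.1)%N, J_set Q Rad u p.1 p.2, clear h p.2,
    hits y e p.2 & e < phi (Rad p.2)].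
  rewrite mem_filter => /andP[/andP[h1 h2] /P_mem[h3 h4]].
  by split => //; [exact: S_J|exact: S_clear h4].
suff eqP' p q : p \in P' -> q \in P' -> Rad p.2 <= Rad q.2 -> p = q.
  case E : P' uP' => [|p [|q l]] //=; rewrite inE negb_or => /andP[/andP[/negP pq _] _].
  exfalso; apply: pq; apply/eqP.
  have pP : p \in P' by rewrite E !inE eqxx.
  have qP : q \in P' by rewrite E !inE eqxx orbT.
  case: (leP (Rad p.2) (Rad q.2)) => [|/ltW] hh; first exact: eqP'.
  by apply/esym/eqP'.
move=> /P'P[p1 Jp cp tp ep] /P'P[q1 Jq cq tq eq] Rpq.
have [e2|ne2] := eqVneq p.2 q.2.
  have e1 : p.1 = q.1.
    apply: (@J_level _ _ p.2); rewrite ?(leq_trans n1_gt0) //.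
    by rewrite e2.
  by rewrite (surjective_pairing p) e1 e2 -surjective_pairing.
have [Qq /andP[_ q2]] := Jq.
have Rqh : Rad q.2 < h.
  apply: lt_trans u_h; apply: lt_le_trans q2 _; apply: u_anti.
  by rewrite -!subn1 leq_sub2r.
exfalso; exact: clear_hits cp Qq (nesym (elimN eqP ne2)) Rpq Rqh tp tq ep eq.
Qed.

End Levels.

(** * Candidates avoiding a family of balls *)

Lemma uniform_bound (T : eqType) (P : seq T) (A : T -> nat -> Prop) :
  (forall p, p \in P -> exists m0, forall m, (m0 <= m)%N -> A p m) ->
  exists m, forall p, p \in P -> A p m.
Proof.
move=> h; suff [m0 hm] : exists m0, forall p m, p \in P -> (m0 <= m)%N -> A p m.
  by exists m0 => p pP; exact: hm.
elim: P h => [|q P IH] h; first by exists 0%N.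
have [|m1 h1] := IH; first by move=> p pP; apply: h; rewrite inE pP orbT.
have [m2 h2] := h q (mem_head _ _).
exists (maxn m1 m2) => p m; rewrite inE geq_max => /orP[/eqP ->|pP] /andP[l_1 l_2].
  exact: h2.
exact: h1.
Qed.

Definition avoids (c2 K rs : R) : Prop :=
  forall (x : X) r, 0 < r -> r <= rs ->
  forall (D : pred nat) (xx : nat -> X) (rr : nat -> R) W,
    (forall i, D i -> 0 < rr i) ->
    (forall m, \sum_(0 <= i < m | D i) rr i `^ s <= W) ->
    (forall m, \sum_(0 <= i < m | D i) rr i `^ delta <= c2 * r `^ delta) ->
  forall gam n2, 0 < gam -> exists xi,
    [/\ Q xi, Rad xi < u n2, mdist x xi < 3 / 4 * r, clear (K * r) xi &
        (forall i, D i -> hits (xx i) (rr i) xi -> rr i < phi (Rad xi)) /\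
        forall m, \sum_(0 <= i < m | D i && hits (xx i) (rr i) xi) rr i `^ s <=
          gam * phi (Rad xi) `^ s].

(** It matters that [c2] is chosen before [K]: the construction uses larger and larger [K] with the
    same [c2]. *)
Lemma avoiding_point : exists c2, 0 < c2 /\
  forall K, 0 < K -> exists rs, 0 < rs /\ avoids c2 K rs.
Proof.
have [c1 [c1_gt0 mc]] := many_clear.
have k2 : 0 < c1 / (2 * C3) by rewrite divr_gt0 // mulr_gt0.
(* With this constant the term [C3 * V] times the sum of [rr i ^ delta] uses up only half of the
   lower bound [c1 * r ^ delta * V]. *)
exists (c1 / (2 * C3)); split => // K K0.
have [rs [rs0 rsP]] := mc K K0; exists rs; split => // x r r_gt0 rrs.
move=> D xx rr W D0 DW Dd gam n2 gam0; apply: contrapT => nex.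
have [n3 n3P] := rsP x r r_gt0 rrs.
have [n4 n4P] := u_small (mulr_gt0 K0 r_gt0).
have [n5 n5P] := u_small r0_gt0.
pose n1 := (maxn (maxn n0 n2) (maxn n3 (maxn n4 n5))).+1.
have [S SP] : {S : nat -> seq X & forall n, (n1 <= n)%N -> [/\ uniq (S n),
        forall xi, xi \in S n ->
          [/\ J_set Q Rad u n xi, mdist x xi < 3 / 4 * r & clear (K * r) xi] &
        c1 * r `^ delta <= (size (S n))%:R * rho (u n) `^ delta]}.
  apply: (@choice _ _ (fun n (Sn : seq X) => (n1 <= n)%N -> [/\ uniq Sn,
        forall xi, xi \in Sn ->
          [/\ J_set Q Rad u n xi, mdist x xi < 3 / 4 * r & clear (K * r) xi] &
        c1 * r `^ delta <= (size Sn)%:R * rho (u n) `^ delta])) => n.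
  case: (leqP n1 n) => n1n; last by exists [::].
  have [|Sn SnP] := n3P n; last by exists Sn.
  by apply: leq_trans n1n; rewrite leqW // !leq_max leqnn !orbT.
have n01 : (n0 <= n1)%N by rewrite leqW // !leq_max leqnn.
have n21 : (n2 <= n1.-1)%N by rewrite /= !leq_max leqnn orbT.
have un1 : u n1 < r0 by apply: n5P; rewrite leqW // !leq_max leqnn !orbT.
have uh : u n1.-1 < K * r by apply: n4P; rewrite /= !leq_max leqnn !orbT.
have S_uniq n : (n1 <= n)%N -> uniq (S n) by move=> /SP[].
have S_J n xi : (n1 <= n)%N -> xi \in S n -> J_set Q Rad u n xi.
  by move=> /SP[_ h _] /h[].
have S_clear n xi : (n1 <= n)%N -> xi \in S n -> clear (K * r) xi.
  by move=> /SP[_ h _] /h[].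
pose th := l2 `^ delta.
have th_lt1 : th < 1.
  have <- : 1 `^ delta = 1 :> R by rewrite powR1.
  by rewrite gt0_ltr_powR // nnegrE ltW.
have W0 : 0 <= W by apply: le_trans (DW 0%N); rewrite big_geq.
have rd : 0 < r `^ delta by rewrite powR_gt0.
(* The number of levels makes the remaining half exceed the terms in [W]; the factor [1 - th] pays
   for replacing [f] by its decrements. *)
have [N NP] := divergent n1
  (((C3 + gam^-1) * W + 1) / (c1 / 2 * r `^ delta * (1 - th))).
pose v := decrement f N; pose V := \sum_(n1 <= n < N) v n * w n.
have v0 n : 0 <= v n by exact: decrement_ge0.
have VN : (C3 + gam^-1) * W + 1 <= c1 / 2 * r `^ delta * V.
  have th1 : 0 < 1 - th by rewrite subr_gt0.
  have hV : (1 - th) * \sum_(n1 <= n < N) f n * w n <= V.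
    apply: sum_decrement_ge => //; first exact: powR_ge0.
    move=> n n1n; have [/andP[_ h] _] := rho_ratio (leq_trans n01 n1n).
    have rn1 : 0 < rho (u n) by exact: rho_pos.
    have rn2 : 0 < rho (u n.+1) by exact: rho_pos.
    rewrite /w ler_pdivlMr ?powR_gt0 // mulrC ler_pdivrMr ?powR_gt0 //.
    by rewrite /th -powRM ?(ltW l2_gt0) ?(ltW rn1) //; apply: le_powR => //; exact: ltW.
  have c10 : 0 < c1 / 2 * r `^ delta by rewrite mulr_gt0 // divr_gt0.
  move: NP; rewrite ler_pdivrMr ?mulr_gt0 // => NP; apply: (le_trans NP).
  by rewrite [leLHS]mulrC -[leLHS]mulrA (ler_pM2l c10).
(* A failed candidate is charged at least its weight [v n]: either one large ball hits it and pays
   [v n], or the small balls hitting it have mass above [gam * phi (Rad xi) ^ s], which after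
   division by [gam] exceeds [f n >= v n]. *)
pose L i xi := D i && (hits (xx i) (rr i) xi && (phi (Rad xi) <= rr i)).
pose Sm i xi := D i && (hits (xx i) (rr i) xi && (rr i < phi (Rad xi))).
pose T i (p : nat * X) := (if L i p.2 then v p.1 else 0) +
  gam^-1 * rr i `^ s * (if Sm i p.2 then 1 else 0).
have T0 i p : 0 <= T i p.
  rewrite /T addr_ge0 //; first by case: ifP.
  by rewrite !mulr_ge0 ?invr_ge0 ?powR_ge0 ?(ltW gam0) //; case: ifP.
pose P := [seq (n, xi) | n <- index_iota n1 N, xi <- S n].
have [m mP] : exists m, forall p, p \in P -> v p.1 <= \sum_(0 <= i < m) T i p.
  apply: uniform_bound => p /allpairsPdep[n [xi [nN xiS ->]]] /=.
  move: nN; rewrite mem_index_iota => /andP[n1n _].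
  have Jxi := S_J _ _ n1n xiS; have [Qxi /andP[xi1 xi2]] := Jxi.
  have fphi : f n <= phi (Rad xi) `^ s.
    apply: le_powR; [exact: ltW|by rewrite ltW // phi_pos|].
    exact: phi_nondecreasing.
  have [[i [Di ti pi]]|nL] := pselect (exists i, [/\ D i, hits (xx i) (rr i) xi &
      phi (Rad xi) <= rr i]).
    exists i.+1 => m im; rewrite (bigD1_seq i) ?mem_index_iota ?iota_uniq //=.
    rewrite -[leLHS]addr0; apply: lerD; last by apply: sumr_ge0.
    rewrite /T /= /L /Sm Di ti pi /= ltNge pi /= mulr0 addr0.
    exact: lexx.
  have small i : D i -> hits (xx i) (rr i) xi -> rr i < phi (Rad xi).
    by move=> Di ti; rewrite ltNge; apply/negP => pi; apply: nL; exists i.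
  have [m0 hm0] : exists m0, gam * phi (Rad xi) `^ s <
      \sum_(0 <= i < m0 | D i && hits (xx i) (rr i) xi) rr i `^ s.
    apply: contrapT => nm; apply: nex; exists xi.
    have [_ /(_ xi xiS)[_ dxi cxi] _] := SP n n1n.
    split => //; last first.
      split => // m; rewrite leNgt; apply/negP => lm; apply: nm.
      by exists m.
    apply: lt_le_trans xi2 _; apply: u_anti; apply: leq_trans n21 _.
    by rewrite -!subn1 leq_sub2r.
  exists m0 => m m0m; apply: (le_trans (decrement_le N f_ge0 n)).
  apply: (le_trans fphi); rewrite -(ler_pM2l gam0); apply: (le_trans (ltW hm0)).
  rewrite mulr_sumr [leRHS](big_cat_nat (n := m0)) //= -[leLHS]addr0.
  apply: lerD; last first.
    by apply: sumr_ge0 => i _; rewrite mulr_ge0 // ltW.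
  rewrite big_mkcond; apply: ler_sum => i _; rewrite /T /= /L /Sm.
  case: ifP => [/andP[Di ti]|_]; last by rewrite mulr_ge0 ?(ltW gam0) //; exact: (T0 i (n, xi)).
  rewrite Di ti (small i Di ti) /= mulr1 mulrDr mulrA mulrV ?unitfE ?gt_eqF // mul1r.
  by rewrite lerDr mulr_ge0 ?(ltW gam0) //; case: ifP.
have lower : c1 * r `^ delta * V <= \sum_(p <- P) v p.1.
  rewrite big_allpairs_dep /= mulr_sumr; apply: ler_sum_nat => n /andP[n1n _].
  rewrite big_const_seq count_predT iter_addr_0 -mulr_natl.
  have [_ _ h] := SP n n1n.
  have rhon : 0 < rho (u n) by exact: rho_pos.
  rewrite [v n * w n]mulrC mulrA; apply: ler_wpM2r => //.
  by rewrite /w ler_pdivrMr // powR_gt0.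
have upper : \sum_(p <- P) v p.1 <=
    \sum_(0 <= i < m | D i) (C3 * (rr i `^ s + rr i `^ delta * V) + gam^-1 * rr i `^ s).
  apply: (@le_trans _ _ (\sum_(p <- P) \sum_(0 <= i < m) T i p)).
    by rewrite big_seq [leRHS]big_seq; apply: ler_sum => p /mP.
  rewrite exchange_big /= [leRHS]big_mkcond; apply: ler_sum => i _.
  rewrite big_split /= -mulr_sumr big_allpairs_dep /= big_allpairs_dep /=.
  rewrite /L /Sm; case: ifP => Di /=; last first.
    by rewrite !big1 ?mulr0 ?addr0 // => n _; rewrite big1.
  apply: lerD.

    apply: le_trans (large_hits_weight N n01 un1 S_uniq S_J (xx i) (D0 i Di)).
    by apply: ler_sum => n _; rewrite -big_mkcond.
  rewrite -[leRHS]mulr1; apply: ler_wpM2l.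
    by rewrite mulr_ge0 ?powR_ge0 // invr_ge0 ltW.
  apply: le_trans (small_hits_unique N (isT : (0 < n1)%N) S_uniq S_J uh S_clear (xx i) (rr i)).
  by apply: ler_sum => n _; rewrite -big_mkcond.
(* Together the bounds give [c1 / 2 * r ^ delta * V <= (C3 + gam^-1) * W], against the choice of
   [N]. *)
have := le_trans lower upper.
rewrite big_split /= -!mulr_sumr big_split /= -mulr_suml.
set s1 := \sum_(_ <= _ < _ | _) rr _ `^ s; set s2 := \sum_(_ <= _ < _ | _) rr _ `^ delta.
have s1W : s1 <= W by exact: DW.
have s2W : s2 <= c1 / (2 * C3) * r `^ delta by exact: Dd.
have V0 : 0 <= V by apply: sumr_ge0 => n _; rewrite mulr_ge0.
have q1 : C3 * (s2 * V) <= c1 / 2 * r `^ delta * V.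
  have -> : c1 / 2 * r `^ delta * V = C3 * (c1 / (2 * C3) * r `^ delta * V).
    by field; rewrite gt_eqF.
  by rewrite (ler_pM2l C3_gt0); apply: ler_wpM2r.
have q2 : C3 * s1 <= C3 * W by rewrite ler_pM2l.
have q3 : gam^-1 * s1 <= gam^-1 * W by rewrite ler_pM2l // invr_gt0.
by lra.
Qed.

(** * One step of the nested construction *)

Let q k : R := k.+1%:R^-1.

Let q_gt0 k : 0 < q k. Proof. by rewrite invr_gt0. Qed.

Let q_le1 k : q k <= 1. Proof. by rewrite invf_le1 // ler1n. Qed.

Let q_anti j k : (j <= k)%N -> q k <= q j.
Proof. by move=> jk; rewrite lef_pV2 ?posrE // ler_nat. Qed.

Let q_small e : 0 < e -> exists k, q k <= e.
Proof.
move=> e0; exists (Num.truncn e^-1); rewrite /q -[leRHS]invrK lef_pV2 ?posrE ?invr_gt0 //.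
by rewrite ltW // truncnS_gt.
Qed.

(** For [y] at distance between [1 - q k / 2] and [1 - q k / 4] times [phi (Rad xi)] from [xi], the
    ball of this radius around [y] stays between [1 - q k] and 1 times [phi (Rad xi)]. *)
Let radius k xi := phi (Rad xi) * q k / 8.

(** The last conclusion is the smallness assumption again, for the new ball and the subfamily
    touching it, so that the step can be iterated. *)
Lemma descend c2 K rs : 0 < c2 -> avoids c2 K rs ->
  forall (x : X) r, 0 < r -> r <= rs ->
  forall (D : pred nat) (xx : nat -> X) (rr : nat -> R) W,
    (forall i, D i -> 0 < rr i) ->
    (forall m, \sum_(0 <= i < m | D i) rr i `^ s <= W) ->
    (forall m, \sum_(0 <= i < m | D i) rr i `^ delta <= c2 * r `^ delta) ->
  forall k bnd n2, 0 < bnd -> exists p : X * X,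
    let xi := p.1 in let y := p.2 in
    [/\ Q xi, Rad xi < u n2, clear (K * r) xi,
        (1 - q k / 2) * phi (Rad xi) <= mdist xi y < (1 - q k / 4) * phi (Rad xi) &
        radius k xi <= bnd] /\
    [/\ mdist x y + radius k xi <= r,
        forall i, D i -> mdist (xx i) y < rr i + radius k xi -> rr i < phi (Rad xi) &
        forall m, \sum_(0 <= i < m | D i && (mdist (xx i) y < rr i + radius k xi))
          rr i `^ delta <= c2 * radius k xi `^ delta].
Proof.
move=> c20 avoid x r r_gt0 rrs D xx rr W D0 DW Dd k bnd n2 bnd0.
have [n3 n3P] := phi_small (@ltr01 R).
have m0 : 0 < Num.min bnd (Num.min (r / 8) r0) by rewrite !lt_min bnd0 r0_gt0 divr_gt0.
have [n4 n4P] := u_small m0.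
have q0 := q_gt0 k; have q1 := q_le1 k.
(* Multiplied by [phi (Rad xi) ^ delta], this is [c2 * radius k xi ^ delta]. *)
have gam0 : 0 < c2 * (q k / 8) `^ delta by rewrite mulr_gt0 // powR_gt0 // divr_gt0.
have [xi [Qxi xin xxi cxi [small mass]]] :=
  avoid x r r_gt0 rrs D xx rr W D0 DW Dd _ (maxn n2 (maxn n3 n4)) gam0.
have Rxi := Rad_gt0 Qxi.
have xin2 : Rad xi < u n2 by apply: lt_le_trans xin _; rewrite u_anti // leq_maxl.
have xin3 : Rad xi <= u n3.
  by apply: le_trans (ltW xin) _; rewrite u_anti // !leq_max leqnn orbT.
have := n3P _ Rxi xin3; rewrite mul1r => phR.
have ph0 := phi_pos Rxi.
have := n4P (maxn n2 (maxn n3 n4)); rewrite !leq_max leqnn !orbT => /(_ isT).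
rewrite !lt_min => /and3P[h1 h2 h3].
have a1 : 0 < (1 - q k / 2) * phi (Rad xi) by rewrite mulr_gt0 //; lra.
have a2 : (1 - q k / 2) * phi (Rad xi) < (1 - q k / 4) * phi (Rad xi).
  by rewrite ltr_pM2r //; lra.
have pq : 0 < phi (Rad xi) * q k by rewrite mulr_gt0.
have pq1 : phi (Rad xi) * q k <= phi (Rad xi) by rewrite ler_piMr // ltW.
have a3 : (1 - q k / 4) * phi (Rad xi) <= r0 by lra.
have [y /andP[y1 y2]] := annulus_nonempty a_gt0 mu_regular xi a1 a2 a3.
have touch_hits i : mdist (xx i) y < rr i + radius k xi -> hits (xx i) (rr i) xi.
  move=> h; have := metric_triangle (xx i) y xi.
  by rewrite (metric_sym y xi) /hits; move: h; rewrite /radius; lra.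
exists (xi, y); split => /=.
  split => //; first by rewrite y1 y2.
  by rewrite /radius; lra.
split.
- by have := metric_triangle x xi y; rewrite /radius; lra.
- by move=> i Di /touch_hits; exact: small.
move=> m; have ds0 : 0 <= delta - s by rewrite subr_ge0 ltW.
have pds : 0 <= phi (Rad xi) `^ (delta - s) by exact: powR_ge0.
(* The balls involved are smaller than [phi (Rad xi)] and [s < delta], so their [s]-mass controls
   their [delta]-mass. *)
apply: (@le_trans _ _ (phi (Rad xi) `^ (delta - s) *
    \sum_(0 <= i < m | D i && hits (xx i) (rr i) xi) rr i `^ s)).
  rewrite big_mkcond [in leRHS]big_mkcond mulr_sumr; apply: ler_sum => i _.
  case: ifP => [/andP[Di ti]|_]; last by case: ifP => _; rewrite mulr_ge0 ?powR_ge0.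
  rewrite Di (touch_hits _ ti) /=.
  have -> : rr i `^ delta = rr i `^ (delta - s) * rr i `^ s.
    rewrite -powRD ?subrK //; apply/implyP => _; rewrite gt_eqF //; exact: D0.
  apply: ler_wpM2r; first exact: powR_ge0.
  apply: le_powR => //; first by rewrite ltW // D0.
  by rewrite ltW // small //; exact: touch_hits.
apply: le_trans (ler_wpM2l pds (mass m)) _.
have -> : c2 * (q k / 8) `^ delta * phi (Rad xi) `^ s =
    phi (Rad xi) `^ s * (c2 * (q k / 8) `^ delta).
  by rewrite mulrC.
rewrite mulrA -powRD ?subrK; last by apply/implyP => _; rewrite gt_eqF.
have q8 : 0 <= q k / 8 by rewrite divr_ge0 // ltW.
rewrite /radius -[phi (Rad xi) * q k / 8]mulrA (powRM _ (ltW ph0) q8).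
by rewrite le_eqVlt; apply/orP; left; apply/eqP; ring.
Qed.

(** * Membership of the limit point in [E_set] *)

Lemma finite_Rad_ge (A : set X) : finite_set A -> A `<=` Q ->
  exists e, 0 < e /\ forall xi, A xi -> e <= Rad xi.
Proof.
move=> /finite_seqP[l ->]; elim: l => [|z l IH] lQ; first by exists 1.
have [|e [e0 eP]] := IH; first by move=> w' wl; apply: lQ; rewrite /= inE wl orbT.
have Rz : 0 < Rad z by apply: Rad_gt0; apply: lQ; rewrite /= mem_head.
exists (Num.min e (Rad z)); split; first by rewrite lt_min e0 Rz.
move=> xi /=; rewrite inE => /orP[/eqP ->|xl]; first by rewrite ge_min lexx orbT.
by rewrite ge_min eP.
Qed.

(* A zeta off the sequence xi with R_{xi_{k+1}} <= R_zeta < R_{xi_k} is handled by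
   clearness of xi_{k+1} when R_zeta < (2/c) phi(R_{xi_k}), and is too far from
   xi_k by separation otherwise. *)
Lemma limit_in_E (n3 : nat) (xi : nat -> X) (x : X) :
  (forall z, 0 < z -> z <= u n3 -> phi z <= c / 2 * z) ->
  (forall k, Q (xi k)) -> (forall k, Rad (xi k) < u (n3 + k)) ->
  (forall k, (1 - q k) * phi (Rad (xi k)) <= mdist x (xi k) < phi (Rad (xi k))) ->
  (forall k, clear (2 / c * phi (Rad (xi k))) (xi k.+1)) ->
  E_set Q Rad phi x.
Proof.
move=> phc Qxi Rxi dxi cxi; split.
  move=> fin; have [|e [e0 eP]] := finite_Rad_ge fin; first by move=> z [].
  have [N NP] := u_small e0.
  have [_ dN] := andP (dxi N).
  have := eP (xi N) (conj (Qxi N) dN).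
  have := Rxi N; have := NP (n3 + N)%N (leq_addl _ _).
  by lra.
move=> [e /= /andP[e0 e1] winf]; apply: winf.
(* Only points with [Rad] at least [Rad (xi k0)] can be within [(1 - e) * phi] of [x], and these are
   finitely many. *)
have [k0 k0P] := q_small e0.
case: QR_system => _ _ /(_ (Rad (xi k0)) (Rad_gt0 (Qxi k0))); apply: sub_finite_set.
move=> z [Qz zx]; split=> //; rewrite leNgt; apply/negP => zk0.
have Rz := Rad_gt0 Qz; have pz := phi_pos Rz.
(* Minimality of such an index places [Rad z] below the radius of its predecessor, in place of
   monotonicity of the radii. *)
have ex : exists k, (k0 <= k)%N && (Rad (xi k) <= Rad z).
  have [N NP] := u_small Rz; exists (maxn k0 N); rewrite leq_maxl /=.
  apply: ltW; apply: lt_trans (Rxi _) (NP _ _).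
  by rewrite (leq_trans (leq_maxr k0 N)) // leq_addl.
case: (ex_minnP ex) => k /andP[k0k kz] kmin.
have k0k' : (k0 < k)%N.
  by rewrite ltn_neqAle k0k andbT; apply/negP => /eqP kk; move: kz; rewrite -kk; lra.
case: k k0k k0k' kz kmin => [//|k] k0k k0k' kz kmin.
have zk : Rad z < Rad (xi k).
  rewrite ltNge; apply/negP => h; have := kmin k; rewrite -ltnS k0k' h => /(_ isT).
  by rewrite ltnn.
have [ez|nez] := pselect (z = xi k.+1).
  have [+ _] := andP (dxi k.+1); rewrite -ez => h.
  have qe : q k.+1 <= e by apply: le_trans k0P; apply: q_anti.
  have : (1 - e) * phi (Rad z) <= (1 - q k.+1) * phi (Rad z) by rewrite ler_pM2r //; lra.
  by move: zx; lra.
have ep : 0 < e * phi (Rad z) by rewrite mulr_gt0.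
have zx' : mdist x z < phi (Rad z) by move: zx; rewrite mulrBl mul1r; lra.
case: (ltP (Rad z) (2 / c * phi (Rad (xi k)))) => hz.
  have far := cxi k z Qz nez kz hz.
  have [_ hx] := andP (dxi k.+1).
  have := metric_triangle (xi k.+1) x z; rewrite (metric_sym _ x).
  by have := phi_pos (Rad_gt0 (Qxi k.+1)); lra.
have zxk : z <> xi k by move=> zE; move: zk; rewrite zE ltxx.
have := separated Qz (Qxi k) zxk; rewrite (min_l (ltW zk)) => sep.
have [_ hx] := andP (dxi k).
have tri := metric_triangle z x (xi k); rewrite (metric_sym z x) in tri.
have pzc : phi (Rad z) <= c / 2 * Rad z.
  apply: phc => //; apply: le_trans (ltW zk) _; apply: le_trans (ltW (Rxi k)) _.
  by apply: u_anti; exact: leq_addr.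
have : phi (Rad (xi k)) <= c / 2 * Rad z.
  have -> : phi (Rad (xi k)) = c / 2 * (2 / c * phi (Rad (xi k))).
    by field; rewrite gt_eqF.
  by rewrite ler_pM2l // divr_gt0.
by lra.
Qed.

(** * Compactness and the iterated construction *)

Hypothesis X_compact : compact [set: X].

(** All later centres lie within [e k] of [y k], and so does a cluster point of the centres. *)
Lemma nested_balls_meet (y : nat -> X) (e : nat -> R) : (forall k, 0 <= e k) ->
  (forall k, mdist (y k) (y k.+1) + e k.+1 <= e k) ->
  exists x, forall k, mdist (y k) x <= e k.
Proof.
move=> e0 nest.
have yj k j : mdist (y k) (y (k + j)%N) + e (k + j)%N <= e k.
  elim: j => [|j IH]; first by rewrite addn0 mdistxx add0r.
  have := nest (k + j)%N; rewrite addnS.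
  by have := metric_triangle (y k) (y (k + j)%N) (y (k + j).+1); lra.
have [x [_ clx]] := X_compact (fmap_proper_filter y eventually_filter) filterT.
exists x => k; apply/ler_addgt0Pr => d d0.
have fk : (y @ \oo) [set y (k + j)%N | j in setT].
  by exists k => //= n /= kn; exists (n - k)%N => //; rewrite subnKC.
have [_ [[j _ <-] /ballP xj]] := clx _ (ball x d) fk (nbhsx_ballx x d d0).
have := yj k j; have := metric_triangle (y k) (y (k + j)%N) x.
by have := e0 (k + j)%N; rewrite (metric_sym (y (k + j)%N) x); lra.
Qed.

Lemma not_covered W : exists e, 0 < e /\
  forall (D : pred nat) (xx : nat -> X) (rr : nat -> R),
    (forall i, D i -> 0 < rr i <= e) ->
    (forall m, \sum_(0 <= i < m | D i) rr i `^ s <= W) ->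
  exists x, E_set Q Rad phi x /\ forall i, D i -> ~ ball (xx i) (rr i) x.
Proof.
have [c2 [c20 av]] := avoiding_point.
(* Chosen so that [K k * radius k xi = 2 / c * phi (Rad xi)], the clearness threshold of
   [limit_in_E]. *)
pose K k := 16 / (c * q k).
have K0 k : 0 < K k by rewrite divr_gt0 // mulr_gt0.
have [rs rsP] := choice (fun k => av (K k) (K0 k)).
have rs0 k : 0 < rs k by have [] := rsP k.
have step k := descend c20 (proj2 (rsP k)).
have [n3 n3P] := phi_small (divr_gt0 c_gt0 (ltr0n R 2)).
have ds0 : 0 < delta - s by rewrite subr_gt0.
pose W1 := Num.max W 1.
have W10 : 0 < W1 by rewrite lt_max ltr01 orbT.
(* Radii up to [e] turn [s]-mass at most [W1] into [delta]-mass at most [c2 * rs 0 ^ delta], which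
   starts the iteration. *)
pose e := (c2 * rs 0%N `^ delta / W1) `^ (delta - s)^-1.
have A0 : 0 < c2 * rs 0%N `^ delta / W1 by rewrite divr_gt0 // mulr_gt0 // powR_gt0.
exists e; split; first by rewrite powR_gt0.
move=> D xx rr Drr DW.
have D0 i : D i -> 0 < rr i by move=> /Drr/andP[].
have e_pow : e `^ (delta - s) = c2 * rs 0%N `^ delta / W1.
  by rewrite /e -powRrM mulVf ?gt_eqF // powRr1 // ltW.
have Dd m : \sum_(0 <= i < m | D i) rr i `^ delta <= c2 * rs 0%N `^ delta.
  apply: (@le_trans _ _ (e `^ (delta - s) * \sum_(0 <= i < m | D i) rr i `^ s)).
    rewrite mulr_sumr; apply: ler_sum => i Di.
    have -> : rr i `^ delta = rr i `^ (delta - s) * rr i `^ s.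
      rewrite -powRD ?subrK //; apply/implyP => _; rewrite gt_eqF //; exact: D0.
    apply: ler_wpM2r; first exact: powR_ge0.
    by have /andP[r1 r2] := Drr i Di; apply: le_powR; rewrite // ltW.
  rewrite e_pow mulrAC ler_pdivrMr // ler_pM2l ?mulr_gt0 ?powR_gt0 //.
  by apply: (le_trans (DW m)); rewrite le_max lexx.
pose D' y r i := D i && (mdist (xx i) y < rr i + r).
have D'0 y r i : D' y r i -> 0 < rr i by move=> /andP[/D0].
have D'W y r m : \sum_(0 <= i < m | D' y r i) rr i `^ s <= W.
  apply: le_trans (DW m); rewrite big_mkcond [leRHS]big_mkcond; apply: ler_sum => i _.
  rewrite /D'; case: ifP => [/andP[-> _] //|_]; case: ifP => // _; exact: powR_ge0.
pose ok k (p : X * X) := [/\ Q p.1, Rad p.1 < u (n3 + k),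
  (1 - q k / 2) * phi (Rad p.1) <= mdist p.1 p.2 < (1 - q k / 4) * phi (Rad p.1),
  radius k p.1 <= rs k &
  (forall i, D i -> mdist (xx i) p.2 < rr i + radius k p.1 -> rr i < phi (Rad p.1)) /\
  forall m, \sum_(0 <= i < m | D' p.2 (radius k p.1) i) rr i `^ delta <=
    c2 * radius k p.1 `^ delta].
have rad0 k xi : Q xi -> 0 < radius k xi.
  by move=> Qxi; rewrite divr_gt0 // mulr_gt0 // phi_pos // Rad_gt0.
have [p0 ok0] : exists p, ok 0%N p.
  have [p [[h1 h2 h3 h4 h5] [h6 h7 h8]]] :=
    step 0%N point (rs 0%N) (rs0 _) (lexx _) D xx rr W D0 DW Dd 0%N (rs 0%N) n3 (rs0 _).
  by exists p; split => //; rewrite addn0.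
pose rel k (p p' : X * X) := clear (2 / c * phi (Rad p.1)) p'.1 /\
  mdist p.2 p'.2 + radius k.+1 p'.1 <= radius k p.1.
have next k p : ok k p -> exists p', ok k.+1 p' /\ rel k p p'.
  move=> [p1 p2 p3 p4 [p5 p6]].
  have [p' [[h1 h2 h3 h4 h5] [h6 h7 h8]]] := step k p.2 (radius k p.1) (rad0 _ _ p1) p4
    (D' p.2 (radius k p.1)) xx rr W (D'0 _ _) (D'W _ _) p6 k.+1 (rs k.+1) (n3 + k.+1)%N (rs0 _).
  (* The new ball is nested in the old one, so discarding the balls that do not touch the old one
     loses nothing. *)
  have D'D i : D i -> mdist (xx i) p'.2 < rr i + radius k.+1 p'.1 -> D' p.2 (radius k p.1) i.
    move=> Di ti; rewrite /D' Di /=.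
    have := metric_triangle (xx i) p'.2 p.2; rewrite (metric_sym p'.2).
    by move: h6 ti; lra.
  exists p'; split; last first.
    split => //; suff <- : K k * radius k p.1 = 2 / c * phi (Rad p.1) by [].
    by rewrite /K /radius; field; rewrite !gt_eqF.
  split => //; split; first by move=> i Di ti; apply: h7 => //; exact: D'D.
  move=> m; apply: le_trans (h8 m).
  rewrite big_mkcond [leRHS]big_mkcond; apply: ler_sum => i _.
  case: ifP => [/andP[Di ti]|_]; last by case: ifP => // _; exact: powR_ge0.
  by rewrite (D'D i Di ti) ti.
(* Dependent choice: [F] takes a dummy value at pairs that are not [ok], so the sequence is a plain
   recursion and the invariant follows by induction. *)
have [F FP] : {F : nat * (X * X) -> X * X & forall kp, ok kp.1 kp.2 ->
    ok kp.1.+1 (F kp) /\ rel kp.1 kp.2 (F kp)}.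
  apply: (@choice _ _ (fun kp p' => ok kp.1 kp.2 -> ok kp.1.+1 p' /\ rel kp.1 kp.2 p')).
  move=> [k p] /=; have [okp|nok] := pselect (ok k p); last by exists p.
  by have [p' h] := next k p okp; exists p'.
pose st := fix st k := if k is k'.+1 then F (k', st k') else p0.
have stok k : ok k (st k).
  by elim: k => [|k IH] //=; have [] := FP (k, st k) IH.
have strel k : rel k (st k) (st k.+1) by have [_] := FP (k, st k) (stok k).
pose xi k := (st k).1; pose y k := (st k).2.
have Qxi k : Q (xi k) by have [] := stok k.
have [x xP] : exists x, forall k, mdist (y k) x <= radius k (xi k).
  apply: nested_balls_meet => k; first by rewrite ltW // rad0.
  by have [] := strel k.
have dx k : (1 - q k) * phi (Rad (xi k)) <= mdist x (xi k) < phi (Rad (xi k)).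
  have [_ _ /andP[h1 h2] _ _] := stok k.
  have h3 := xP k; have ph0 := phi_pos (Rad_gt0 (Qxi k)).
  have pq : 0 < phi (Rad (xi k)) * q k by rewrite mulr_gt0.
  have t1 := metric_triangle (xi k) x (y k); have t2 := metric_triangle (xi k) (y k) x.
  rewrite (metric_sym x (y k)) in t1; rewrite (metric_sym x (xi k)).
  move: h1 h2 h3; rewrite -/(xi k) -/(y k) /radius => h1 h2 h3.
  by apply/andP; split; lra.
exists x; split.
  apply: (limit_in_E (n3 := n3) (xi := xi)) => //.
  - by move=> k; have [] := stok k.
  - by move=> k; have [] := strel k.
move=> i Di /ballP xi_x.
(* A ball containing [x] touches every nested ball, so its radius is below all [phi (Rad (xi k))],
   which tend to 0. *)
have small k : rr i < phi (Rad (xi k)).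
  have [_ _ _ _ [h _]] := stok k; apply: h => //.
  have := metric_triangle (xx i) x (y k); have := xP k.
  by rewrite (metric_sym x (y k)) -/(xi k) -/(y k); lra.
have [N NP] := u_small (D0 i Di); have [n4 n4P] := phi_small (@ltr01 R).
pose k := maxn N n4.
have [_ Rk _ _ _] := stok k.
have Rk0 := Rad_gt0 (Qxi k).
have := n4P _ Rk0; rewrite (le_trans (ltW Rk)) ?u_anti //; last first.
  by rewrite (leq_trans (leq_maxr N n4)) // leq_addl.
move=> /(_ isT); have := NP (n3 + k)%N.
rewrite (leq_trans (leq_maxl N n4)) ?leq_addl // => /(_ isT).
by have := small k; move: Rk; rewrite -/(xi k) mul1r; lra.
Qed.

End Approximation.

Theorem theorem1p1 (R : realType) (X : pmetricType R)
    (mu : probability (borel X) R)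
    (delta r0 a b t : R) (u : nat -> R)
    (Q : set X) (Rad : X -> R) (rho phi : R -> R)
    (X_compact : compact [set: X])
    (mu_non_atomic : non_atomic mu)
    (delta_gt0 : 0 < delta) (r0_gt0 : 0 < r0) (a_bounds : 0 < a < 1) (b_gt1 : 1 < b)
    (mu_regular : @delta_regular R X mu delta r0 a b)
    (t_bounds : 0 < t < 1)
    (u_geometric : forall n, u n = t ^+ n)
    (u_ratio : (limn_esup (fun n => (u n / u n.+1)%:E) < +oo)%E)
    (QR_system : is_system Q Rad)
    (rho_pos : pos_fun rho)
    (rho_nondecreasing : pos_nondecreasing rho)
    (rho_cvg0 : rho x @[x --> 0^'+] --> 0)
    (QR_well_distributed : @well_distributed R X mu r0 Q Rad rho u)
    (rho_u_regular : u_regular u rho)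
    (phi_pos : pos_fun phi)
    (phi_nondecreasing : pos_nondecreasing phi)
    (phi_cvg0 : phi x / x @[x --> 0^'+] --> 0)
    (phi_summable :
      (\esum_(xi in Q) ((phi (Rad xi) / Rad xi) `^ delta)%:E < +oo)%E)
    (phi_rho : limn_esup (fun n => (phi (u n) / rho (u n))%:E) = 0%E) :
  forall s : R, 0 < s < delta ->
  let g := fun x : R => phi x `^ s / rho x `^ delta in
  let G := limn_esup (fun n => (g (u n))%:E) in
  (G = 0%E -> (\sum_(1 <= n <oo) (g (u n))%:E = +oo)%E ->
    hausdorff_measure s (E_set Q Rad phi) = +oo%E) /\
  ((0 < G)%E -> hausdorff_measure s (E_set Q Rad phi) = +oo%E).
Proof.
move=> s /andP[s0 sd] g G.
have [t0 t1] := andP t_bounds; have [a0 _] := andP a_bounds.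
have b0 : 0 < b by exact: lt_trans b_gt1.
have [c [kappa [/andP[c0 c1] /andP[k0 k1] sep dist]]] := QR_well_distributed.
have [n0 [l1 [l2 [l10 l12 l21 ratio]]]] := rho_u_regular.
have main : (forall n1 A, exists N, A <= \sum_(n1 <= n < N) g (u n)) ->
    hausdorff_measure s (E_set Q Rad phi) = +oo%E.
  move=> div; apply: hausdorff_measure_infty => W.
  exact: (not_covered delta_gt0 r0_gt0 a0 b0 mu_regular t0 t1 u_geometric
    QR_system rho_pos c0 c1 k0 sep dist l10 (lt_trans l10 l12) l21 ratio
    phi_pos phi_nondecreasing phi_cvg0 phi_summable s0 sd div X_compact W).
have g0 n : 0 <= g (u n) by rewrite divr_ge0 // powR_ge0.
split; first by move=> _ goo; apply: main; exact: series_unbounded goo.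
by move=> G0; apply: main; exact: limsup_unbounded G0.
Qed.
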